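(* For any $N\in\mathbb{N}$ and $\Omega:=\prod_{i=1}^N[a_i,b_i]$, the set $\mathbf{\Pi}_N[\Omega]$ of (scalar) $N$D 3-PI operators, with multiplication defined by composition and involution defined by the adjoint with respect to the $L_2[\Omega]$ inner product, is a $*$-algebra.
   Context: A univariate 3-PI operator on $[a,b]$ (set denoted $\mathbf{\Pi}_1[a,b]$) is a bounded operator $\mathcal{P}$ on $L_2[a,b]$ (real-valued functions) for which there exist polynomials $P_0\in\mathbb{R}[s]$, $P_1,P_2\in\mathbb{R}[s,\theta]$ with $$(\mathcal{P}\mathbf{v})(s)=P_0(s)\mathbf{v}(s)+\int_a^sP_1(s,\theta)\mathbf{v}(\theta)\,d\theta+\int_s^bP_2(s,\theta)\mathbf{v}(\theta)\,d\theta.$$ For $\Omega=\prod_{i=1}^N[a_i,b_i]$, a univariate operator $\mathcal{P}_i\in\mathbf{\Pi}_1[a_i,b_i]$ is extended to $L_2[\Omega]$ by letting it act on the variable $s_i$ only: $(\mathcal{P}_i\mathbf{v})(s):=(\mathcal{P}_i\mathbf{v}(s_1,\dots,s_{i-1},\bullet,s_{i+1},\dots,s_N))(s_i)$. An operator $\mathcal{P}\in\mathcal{L}(L_2[\Omega])$ is an $N$D 3-PI operator, $\mathcal{P}\in\mathbf{\Pi}_N[\Omega]$, if there exist $M\in\mathbb{N}$ and $\mathcal{P}_{j,i}\in\mathbf{\Pi}_1[a_i,b_i]$ such that $\mathcal{P}=\sum_{j=1}^M\prod_{i=1}^N\mathcal{P}_{j,i}$, where each $\mathcal{P}_{j,i}$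 acts on variable $s_i$ and products denote composition. *)

(* Defs.v *)
From HB Require Import structures.
From mathcomp Require Import all_boot all_order all_algebra.
From mathcomp Require Import all_classical all_reals all_analysis.
From mathcomp Require Import ess_sup_inf measurable_realfun.

Set Implicit Arguments.
Unset Strict Implicit.
Unset Printing Implicit Defensive.

Import Order.TTheory GRing.Theory Num.Theory.
Import numFieldNormedType.Exports.

Local Open Scope classical_set_scope.
Local Open Scope ring_scope.

(* The library's quotient space [LspaceType mu p1] carries no algebraic
   structure; we equip it with the vector space operations induced by those of
   [LfunType mu p1] (measurable functions of finite L^p norm). *)
Section Lspace_lmodule.
Context d (T : measurableType d) (R : realType).
Variables (mu : {measure set T -> \bar R}) (p : \bar R) (p1 : (1 <= p)%E).
Local Open Scope quotient_scope.

Lemma ae_eq_Lnorm (f g : {mfun T >-> R}) : f = g %[ae mu] ->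
  'N[mu]_p[EFin \o f]%E = 'N[mu]_p[EFin \o g]%E.
Proof.
move=> fg; rewrite unlock; case: p p1 => [r _||//].
- have mN (h : {mfun T >-> R}) :
      measurable_fun setT (fun x => `|(EFin \o h) x| `^ r)%E.
    apply/measurable_EFinP.
    apply/(@measurableT_comp _ _ _ _ _ _ (fun x : R => x `^ r)%R) => //.
    exact/measurableT_comp.
  congr (_ `^ _)%E; apply: ge0_ae_eq_integral => //.
  + by move=> x _; exact: poweR_ge0.
  + by move=> x _; exact: poweR_ge0.
  + by apply: filterS fg => x /= fgx _; rewrite fgx.
- move=> _; case: ifPn => // _; apply: eq_ess_sup.
  by apply: filterS fg => x /= ->.
Qed.

Let mf (u : LspaceType mu p1) : {mfun T >-> measurableTypeR R} :=
  repr (u : {mfun_ mu, T >-> measurableTypeR R}).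

Let Lrepr_subproof (u : LspaceType mu p1) : (u : T -> R) \in Lfun mu p.
Proof.
rewrite inE; apply/andP; split; rewrite inE.
  exact: (@measurable_funPT _ _ _ _ (mf u)).
exact: Lebesgue_finite.
Qed.

Definition Lrepr (u : LspaceType mu p1) : LfunType mu p1 :=
  Lfun_Sub p1 (Lrepr_subproof u).

Let mfunR (f : LfunType mu p1) : {mfun T >-> measurableTypeR R} :=
  HB.pack_for {mfun T >-> measurableTypeR R} (f : T -> measurableTypeR R)
    (@isMeasurableFun.Build _ _ T (measurableTypeR R) f
      (@measurable_funPT _ _ _ _ f)).

Let aeclass (f : LfunType mu p1) : {mfun_ mu, T >-> measurableTypeR R} :=
  \pi_({mfun_ mu, T >-> measurableTypeR R}) (mfunR f).

Let aeclassE (f : LfunType mu p1) : (aeclass f : T -> R) = f %[ae mu].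
Proof.
have /eqmodP/asboolP := reprK (aeclass f); exact.
Qed.

Let aeclass_finite (f : LfunType mu p1) : finite_norm mu p (aeclass f).
Proof.
rewrite /finite_norm.
have mh : (aeclass f : T -> R) \in mfun.
  by rewrite inE; exact: (@measurable_funPT _ _ _ _ (repr (aeclass f))).
pose h : {mfun T >-> R} := mfun_Sub mh.
have -> : 'N[mu]_p[EFin \o (aeclass f : T -> R)]%E = 'N[mu]_p[EFin \o f]%E.
  by apply: (@ae_eq_Lnorm h f); exact: aeclassE.
exact: Lfunction_finite.
Qed.

Definition Lclass (f : LfunType mu p1) : LspaceType mu p1 :=
  HB.pack_for (LspaceType mu p1) (aeclass f)
    (@isFinLebesgue.Build _ _ _ _ _ p1 (aeclass f) (aeclass_finite f)).

Lemma Lclass_ae (f : LfunType mu p1) : (Lclass f : T -> R) = f %[ae mu].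
Proof. exact: aeclassE. Qed.

Lemma Lspace_eqP (u v : LspaceType mu p1) :
  u = v <-> (u : T -> R) = v %[ae mu].
Proof.
split=> [->|uv]; first exact: aeW.
have : LebesgueSpace.sort u = LebesgueSpace.sort v.
  by rewrite -[LHS]reprK -[RHS]reprK; apply/eqmodP/asboolP.
case: u v {uv} => [u [[uf]]] [v [[vf]]] /= uv.
by case: _ / uv vf => vf; rewrite (Prop_irrelevance uf vf).
Qed.

Lemma LreprE (u : LspaceType mu p1) : (Lrepr u : T -> R) = u.
Proof. by []. Qed.

HB.instance Definition _ := gen_eqMixin (LspaceType mu p1).
HB.instance Definition _ := gen_choiceMixin (LspaceType mu p1).

Let zero : LspaceType mu p1 := Lclass 0.
Let opp (u : LspaceType mu p1) : LspaceType mu p1 := Lclass (- Lrepr u).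
Let add (u v : LspaceType mu p1) : LspaceType mu p1 :=
  Lclass (Lrepr u + Lrepr v).
Let scale (c : R) (u : LspaceType mu p1) : LspaceType mu p1 :=
  Lclass (c *: Lrepr u).

Let zeroE : (zero : T -> R) = cst 0 %[ae mu].
Proof. exact: Lclass_ae. Qed.
Let oppE u : (opp u : T -> R) = \- (u : T -> R) %[ae mu].
Proof. exact: Lclass_ae. Qed.
Let addE u v : (add u v : T -> R) = (u : T -> R) \+ v %[ae mu].
Proof. exact: Lclass_ae. Qed.
Let scaleE c u : (scale c u : T -> R) = (fun x => c * (u x : R)) %[ae mu].
Proof. exact: Lclass_ae. Qed.

Let aeI (P Q : T -> Prop) : (\forall x \ae mu, P x) ->
  (\forall x \ae mu, Q x) -> \forall x \ae mu, P x /\ Q x.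
Proof. by move=> aP aQ; apply: filterS2 aP aQ => x; split. Qed.

Let addA : associative add.
Proof.
move=> u v w; apply/Lspace_eqP.
have := aeI (aeI (addE u (add v w)) (addE v w))
  (aeI (addE (add u v) w) (addE u v)).
by apply: filterS => x [[/(_ I) + /(_ I) +] [/(_ I) + /(_ I) +]] _
  => /= -> -> -> ->; rewrite addrA.
Qed.

Let addC : commutative add.
Proof.
move=> u v; apply/Lspace_eqP; have := aeI (addE u v) (addE v u).
by apply: filterS => x [/(_ I)/= -> /(_ I)/= ->] _; rewrite addrC.
Qed.

Let add0 : left_id zero add.
Proof.
move=> u; apply/Lspace_eqP; have := aeI (addE zero u) zeroE.
by apply: filterS => x [/(_ I)/= -> /(_ I)/= ->] _; rewrite add0r.
Qed.

Let addN : left_inverse zero opp add.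
Proof.
move=> u; apply/Lspace_eqP; have := aeI (addE (opp u) u) (aeI (oppE u) zeroE).
by apply: filterS => x [/(_ I)/= -> [/(_ I)/= -> /(_ I)/= ->]] _; rewrite addNr.
Qed.

HB.instance Definition _ :=
  GRing.isZmodule.Build (LspaceType mu p1) addA addC add0 addN.

Let scaleA c e u : scale c (scale e u) = scale (c * e) u.
Proof.
apply/Lspace_eqP.
have := aeI (scaleE c (scale e u)) (aeI (scaleE e u) (scaleE (c * e) u)).
by apply: filterS => x [/(_ I)/= -> [/(_ I)/= -> /(_ I)/= ->]] _; rewrite mulrA.
Qed.

Let scale1 : left_id 1 scale.
Proof.
move=> u; apply/Lspace_eqP; move: (scaleE 1 u).
by apply: filterS => x /(_ I) + _ => /= ->; rewrite mul1r.
Qed.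

Let scaleDr : right_distributive scale add.
Proof.
move=> c u v; apply/Lspace_eqP.
have := aeI (aeI (aeI (scaleE c (add u v)) (addE u v))
  (addE (scale c u) (scale c v))) (aeI (scaleE c u) (scaleE c v)).
apply: filterS => x [[[/(_ I)/= h1 /(_ I)/= h2] /(_ I)/= h3]].
by move=> [/(_ I)/= h4 /(_ I)/= h5] _; rewrite h1 h2 h3 h4 h5 mulrDr.
Qed.

Let scaleDl u : {morph scale^~ u : a b / a + b >-> add a b}.
Proof.
move=> c e; apply/Lspace_eqP.
have := aeI (aeI (scaleE (c + e) u) (addE (scale c u) (scale e u)))
  (aeI (scaleE c u) (scaleE e u)).
apply: filterS => x [[/(_ I)/= h1 /(_ I)/= h2] [/(_ I)/= h3 /(_ I)/= h4]] _.
by rewrite h1 h2 h3 h4 mulrDl.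
Qed.

HB.instance Definition _ := GRing.Zmodule_isLmodule.Build R (LspaceType mu p1)
  scaleA scale1 scaleDr scaleDl.

Lemma Lspace0E : ((0 : LspaceType mu p1) : T -> R) = cst 0 %[ae mu].
Proof. exact: zeroE. Qed.

Lemma LspaceDE (u v : LspaceType mu p1) :
  (u + v : T -> R) = (u : T -> R) \+ v %[ae mu].
Proof. exact: addE. Qed.

Lemma LspaceNE (u : LspaceType mu p1) : (- u : T -> R) = \- (u : T -> R) %[ae mu].
Proof. exact: oppE. Qed.

Lemma LspaceZE c (u : LspaceType mu p1) :
  (c *: u : T -> R) = (fun x => c * (u x : R)) %[ae mu].
Proof. exact: scaleE. Qed.

End Lspace_lmodule.

Lemma product_sigma_finite d1 d2 (T1 : measurableType d1)
    (T2 : measurableType d2) (R : realType)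
    (m1 : {sigma_finite_measure set T1 -> \bar R})
    (m2 : {sigma_finite_measure set T2 -> \bar R}) :
  sigma_finite setT (m1 \x m2)%E.
Proof.
have /sigma_finiteP[F [TF ndF Foo]] := sigma_finiteT m1.
have /sigma_finiteP[G [TG ndG Goo]] := sigma_finiteT m2.
exists (fun n => F n `*` G n).
  rewrite -setXTT TF TG predeqE => -[x y]; split.
    move=> [/= [n _ Fnx] [k _ Gky]]; exists (maxn n k) => //; split.
    - by move: x Fnx; exact/subsetPset/ndF/leq_maxl.
    - by move: y Gky; exact/subsetPset/ndG/leq_maxr.
  by move=> [n _ []/= ? ?]; split; exists n.
move=> k; have [? ?] := Foo k; have [? ?] := Goo k.
split; first exact: measurableX.
by rewrite product_measure1E// lte_mul_pinfty// ge0_fin_numE.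
Qed.

Section tuple_measure.
Context (R : realType).
Local Notation TR := (measurableTypeR R).

Section cons.
Variable n : nat.

Definition cons_pair (x : TR * n.-tuple TR) : n.+1.-tuple TR :=
  [tuple of x.1 :: x.2].

Lemma measurable_cons_pair : measurable_fun setT cons_pair.
Proof. exact: measurable_cons. Qed.

Variable m : {sigma_finite_measure set (n.-tuple TR) -> \bar R}.

Definition lebesgue_cons : set (n.+1.-tuple TR) -> \bar R :=
  pushforward (@lebesgue_measure R \x m)%E cons_pair.

Let lebesgue_cons_measure : {measure set (n.+1.-tuple TR) -> \bar R} :=
  measure_function_pushforward__canonical__measure_function_Measure
    (@lebesgue_measure R \x m)%E measurable_cons_pair.

HB.instance Definition _ := isMeasure.Build _ _ _ lebesgue_cons
  (@measure0 _ _ _ lebesgue_cons_measure)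
  (@measure_ge0 _ _ _ lebesgue_cons_measure)
  (@measure_semi_sigma_additive _ _ _ lebesgue_cons_measure).

Let lebesgue_cons_sigma_finite : sigma_finite setT lebesgue_cons.
Proof.
have [F TF Foo] := product_sigma_finite (@lebesgue_measure R) m.
pose G (t : n.+1.-tuple TR) : TR * n.-tuple TR := (thead t, [tuple of behead t]).
have mG : measurable_fun setT G.
  apply/measurable_fun_pairP; split; first exact: measurable_tnth.
  exact: measurable_behead.
exists (fun k => G @^-1` F k).
  by rewrite -preimage_bigcup -TF preimage_setT.
move=> k; have [mF Fk] := Foo k; split.
  by rewrite -[X in measurable X]setTI; exact: mG.
rewrite /lebesgue_cons /pushforward -comp_preimage.
rewrite (_ : G \o cons_pair = id)//; apply/funext => -[x t] /=.
by congr pair; apply/val_inj.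
Qed.

HB.instance Definition _ :=
  Measure_isSigmaFinite.Build _ _ _ lebesgue_cons lebesgue_cons_sigma_finite.

End cons.

Fixpoint lebesgue_tuple n : {sigma_finite_measure set (n.-tuple TR) -> \bar R} :=
  match n with
  | 0%N => [the {sigma_finite_measure set _ -> \bar R} of dirac [tuple]]
  | n'.+1 => [the {sigma_finite_measure set _ -> \bar R} of
               lebesgue_cons (lebesgue_tuple n')]
  end.

Definition box n (a b : 'I_n -> R) : set (n.-tuple TR) :=
  [set s | forall i, tnth s i \in `[a i, b i]].

Lemma measurable_box n (a b : 'I_n -> R) : measurable (box a b).
Proof.
rewrite (_ : box a b = \big[setI/setT]_(i < n) ((@tnth n TR ^~ i) @^-1` `[a i, b i])).
  apply: bigsetI_measurable => i _.
  rewrite -[X in measurable X]setTI.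
  apply: (@measurable_tnth _ TR n i) => //; exact: measurable_itv.
rewrite -bigcap_seq; apply/seteqP; split=> s /= h i; first by move=> _; exact: h.
by apply: h; rewrite /= mem_index_enum.
Qed.

Lemma lebesgue_tuple_box n (a b : 'I_n -> R) : (forall i, a i <= b i) ->
  lebesgue_tuple n (box a b) = (\prod_(i < n) (b i - a i))%:E.
Proof.
elim: n => [|n ih] in a b * => ab.
  rewrite big_ord0 /= diracE (_ : _ \in _ = true)//.
  by apply/mem_set => -[].
rewrite [LHS]/(lebesgue_cons _ _) /lebesgue_cons /pushforward.
rewrite (_ : _ @^-1` _ = `[a ord0, b ord0]%classic `*`
    box (a \o lift ord0) (b \o lift ord0)); last first.
  apply/seteqP; split=> -[x t] /=.
    by move=> h; split=> [|i]; [have := h ord0|have := h (lift ord0 i)];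
      rewrite ?tnthS.
  move=> [h0 h] i; case: (unliftP ord0 i) => [j ->|->]; rewrite ?tnthS//.
rewrite product_measure1E//=; last exact: measurable_box.
rewrite ih; last by move=> i; exact: ab.
rewrite [RHS](congr1 EFin (@big_ord_recl R 1 *%R n (fun i => b i - a i))).
rewrite lebesgue_measure_itv/= lte_fin EFinM; congr (_ * _)%E.
by case: ltgtP (ab ord0) => [//|//|->]; rewrite subrr.
Qed.

End tuple_measure.

Section L2.
Context d (T : measurableType d) (R : realType).
Variable mu : {measure set T -> \bar R}.
Local Notation L2 := (LspaceType2 mu).

Definition L2norm (u : L2) : R := fine 'N[mu]_2[EFin \o (u : T -> R)]%E.

Definition L2dot (u v : L2) : R := \int[mu]_x ((u x : R) * (v x : R)).

Definition bounded_operator (P : L2 -> L2) : Prop :=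
  linear P /\ exists C : R, forall u, L2norm (P u) <= C * L2norm u.

Definition is_adjoint (P Q : L2 -> L2) : Prop :=
  bounded_operator Q /\ forall u v, L2dot (P u) v = L2dot u (Q v).

(* [adjoint P] is meaningful only when an adjoint of [P] exists; it is then
   unique (lemma [is_adjoint_unique]). *)
Definition adjoint (P : L2 -> L2) : L2 -> L2 := xget 0 [set Q | is_adjoint P Q].

Let Lfun_L2 (u : L2) : (u : T -> R) \in Lfun mu 2%:E.
Proof. exact: (LfunP (Lrepr u)). Qed.

Let mfun_L2 (u : L2) : measurable_fun setT (u : T -> R).
Proof. by have := Lfun_L2 u; rewrite inE => /andP[]; rewrite inE. Qed.

Lemma L2_integrableM (u v : L2) :
  mu.-integrable setT (EFin \o (fun x => (u x : R) * (v x : R))).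
Proof. by apply/Lfun1_integrable/Lfun2_mul_Lfun1; exact: Lfun_L2. Qed.

Lemma L2dotBr (u v w : L2) : L2dot u (v - w) = L2dot u v - L2dot u w.
Proof.
rewrite /L2dot -RintegralB//; [|exact: L2_integrableM..].
congr fine; apply: ae_eq_integral => //.
- exact: (measurable_int mu (L2_integrableM u (v - w))).
- have := integrableB measurableT (L2_integrableM u v) (L2_integrableM u w).
  exact: measurable_int.
- apply: filterS2 (LspaceDE v (- w)) (LspaceNE w) => x /(_ I)/= vw /(_ I)/= nw _.
  by rewrite vw nw mulrBr.
Qed.

Lemma L2dot_eq0 (u : L2) : L2dot u u = 0 -> u = 0.
Proof.
move=> uu0; have iu := L2_integrableM u u.
have : (\int[mu]_x `|((u x : R) * (u x : R))%:E| = 0)%E.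
  under eq_integral do rewrite abse_EFin normrM -expr2 real_normK ?num_real// expr2.
  by rewrite -[LHS]fineK ?integrable_fin_num//; congr EFin.
move=> /ae_eq_integral_abs - /(_ measurableT (measurable_int mu iu)) u0.
apply/Lspace_eqP; apply: filterS2 u0 (Lspace0E mu (lee1n 2)).
move=> x /(_ I)/= -[/eqP]; rewrite mulf_eq0 orbb => /eqP ux0 /(_ I)/= h _.
by rewrite ux0 h.
Qed.

Lemma is_adjoint_unique (P Q Q' : L2 -> L2) :
  is_adjoint P Q -> is_adjoint P Q' -> Q = Q'.
Proof.
move=> [_ PQ] [_ PQ']; apply/funext => v; apply/eqP; rewrite -subr_eq0; apply/eqP.
by apply: L2dot_eq0; rewrite L2dotBr -PQ -PQ' subrr.
Qed.

End L2.

Section PI.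
Context (R : realType).
Local Notation TR := (measurableTypeR R).

(* L_2 over a set D is L_2 for the Lebesgue measure restricted to D: values
   outside D are irrelevant. *)
Definition itv_measure (a b : R) : {measure set TR -> \bar R} :=
  mrestr (@lebesgue_measure R) (measurable_itv `[a, b]).

Definition box_measure N (a b : 'I_N -> R) :
    {measure set (N.-tuple TR) -> \bar R} :=
  mrestr (@lebesgue_tuple R N) (measurable_box a b).

Definition L2itv (a b : R) := LspaceType2 (itv_measure a b).
Definition L2box N (a b : 'I_N -> R) := LspaceType2 (box_measure a b).

(* Bivariate polynomials are elements of {poly {poly R}}; [p.[s, t]] evaluates
   the outer variable at [s] and the inner one at [t]. *)
Definition Pi1 (a b : R) : set (L2itv a b -> L2itv a b) :=
  [set P | bounded_operator P /\
    exists (P0 : {poly R}) (P1 P2 : {poly {poly R}}),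
      forall v : L2itv a b, \forall s \ae itv_measure a b,
        P v s = P0.[s] * v s
              + \int[lebesgue_measure]_(t in `[a, s]) (P1.[s, t] * v t)
              + \int[lebesgue_measure]_(t in `[s, b]) (P2.[s, t] * v t) :> R].

Definition set_coord N (i : 'I_N) (s : N.-tuple TR) (t : TR) : N.-tuple TR :=
  [tuple if k == i then t else tnth s k | k < N].

Definition is_slice N (a b : 'I_N -> R) (i : 'I_N) (s : N.-tuple TR)
    (v : L2box a b) (w : L2itv (a i) (b i)) : Prop :=
  (w : TR -> R) = (fun t => v (set_coord i s t) : R)
    %[ae itv_measure (a i) (b i)].

(* Q is the extension of P to functions of N variables: for almost every s, the
   class of (Q v)(s_1, .., s_(i-1), -, s_(i+1), .., s_N) is the image under P of
   the class of v(s_1, .., s_(i-1), -, s_(i+1), .., s_N). *)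
Definition acts_on_coord N (a b : 'I_N -> R) (i : 'I_N)
    (P : L2itv (a i) (b i) -> L2itv (a i) (b i))
    (Q : L2box a b -> L2box a b) : Prop :=
  forall v : L2box a b, \forall s \ae box_measure a b,
    exists2 w : L2itv (a i) (b i),
      is_slice s v w & is_slice s (Q v) (P w).

Definition PiN N (a b : 'I_N -> R) : set (L2box a b -> L2box a b) :=
  [set P | bounded_operator P /\
    exists (M : nat)
      (p : 'I_M -> forall i : 'I_N, L2itv (a i) (b i) -> L2itv (a i) (b i))
      (Q : 'I_M -> 'I_N -> L2box a b -> L2box a b),
      [/\ forall j i, Pi1 (p j i),
          forall j i, acts_on_coord (p j i) (Q j i) &
          P = \sum_(j < M) \big[(fun f g => f \o g)/id]_(i < N) Q j i]].

End PI.

Arguments Pi1 {R} a b.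
Arguments PiN {R N} a b.

(* A unital *-algebra over R (with trivial involution on the scalars, as for
   the reals), carried by a subset S of an R-module A. *)
Record is_star_algebra (R : comNzRingType) (A : lmodType R) (S : set A)
    (mul : A -> A -> A) (star : A -> A) : Prop := IsStarAlgebra {
  star_algebra0 : S 0;
  star_algebraD : forall x y, S x -> S y -> S (x + y);
  star_algebraZ : forall (c : R) x, S x -> S (c *: x);
  star_algebraM : forall x y, S x -> S y -> S (mul x y);
  star_algebra_mulA : forall x y z, S x -> S y -> S z ->
    mul x (mul y z) = mul (mul x y) z;
  star_algebra_mulDl : forall x y z, S x -> S y -> S z ->
    mul (x + y) z = mul x z + mul y z;
  star_algebra_mulDr : forall x y z, S x -> S y -> S z ->
    mul x (y + z) = mul x y + mul x z;
  star_algebra_mulZl : forall (c : R) x y, S x -> S y ->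
    mul (c *: x) y = c *: mul x y;
  star_algebra_mulZr : forall (c : R) x y, S x -> S y ->
    mul x (c *: y) = c *: mul x y;
  star_algebra_unit : exists2 e, S e &
    forall x, S x -> mul e x = x /\ mul x e = x;
  star_algebra_star : forall x, S x -> S (star x);
  star_algebra_starK : forall x, S x -> star (star x) = x;
  star_algebra_starD : forall x y, S x -> S y -> star (x + y) = star x + star y;
  star_algebra_starZ : forall (c : R) x, S x -> star (c *: x) = c *: star x;
  star_algebra_starM : forall x y, S x -> S y ->
    star (mul x y) = mul (star y) (star x)
}.

(* Main.v *)
Require Import Defs.
From HB Require Import structures.
From mathcomp Require Import all_boot all_order all_algebra.
From mathcomp Require Import all_classical all_reals all_analysis.
From mathcomp Require Import measurable_realfun ring lra.

Set Implicit Arguments.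
Unset Strict Implicit.
Unset Printing Implicit Defensive.

Import Order.TTheory GRing.Theory Num.Theory.
Import numFieldNormedType.Exports.

Local Open Scope classical_set_scope.
Local Open Scope ring_scope.

(* An operator acting on one variable s_i is, up to null sets,
     (Q v)(s) = m(s_i) v(s) + \int k(s_i, t) v(s_1, .., t, .., s_N) dt
   with m and k bounded and measurable; for a 3-PI operator m is polynomial and
   k is polynomial on either side of the diagonal. The only property of the
   product measure such operators depend on is that exchanging s_i and t
   preserves ds dt, and the univariate case is the instance where v depends on
   t alone. Tonelli, Fubini and Cauchy-Schwarz give boundedness, the composition
   rule k_3(s, t) = m_1(s) k_2(s, t) + k_1(s, t) m_2(t)
   + \int k_1(s, r) k_2(r, t) dr, the adjoint (transposed kernel) and
   commutation of operators acting on different variables. Integrating a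
   polynomial in r over an interval with end points among a, b, s, t gives a
   polynomial in (s, t), so 3-PI kernels are stable under the composition rule.
   Products of operators acting on distinct variables can then be multiplied
   and transposed factor by factor. *)

(** * Fubini for finite measures *)

(** Two features shape the details. Elements of L2 are classes modulo null sets, and [Rintegral] is
    [fine] of an extended integral, so an infinite value silently becomes 0. A slice of a square
    integrable function is known to be square integrable only for almost every base point;
    identities between operators are therefore proved at almost every point, on slices where all
    integrals converge. The bridge between the box and its slices is that a null set has null slices
    through almost every point, and conversely for measurable sets. The converse also shows that
    [acts_on_coord] determines the extension of an operator, so the operators given abstractly in
    [PiN] are the explicit kernel operators. Polynomials are unbounded on the line, hence cut off
    outside the interval. The composition of two 3-PI kernels has the 3-PI form off the diagonal
    only, which suffices because the diagonal has null sections. Since [adjoint] is a choice,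
    nothing can be read off it: an explicit adjoint of each sum of products is exhibited, and
    uniqueness does the rest. *)

Definition finite_measure_of d (T : measurableType d) (R : realType)
    (m : {measure set T -> \bar R}) (finm : (m setT < +oo)%E) :
    {finite_measure set T -> \bar R} :=
  HB.pack_for {finite_measure set T -> \bar R} (Measure.sort m)
    (@Measure_isFinite.Axioms_ _ _ _ (Measure.sort m) _
      (Measure.measure_function_Content_isMeasure_mixin (Measure.class m))
      (lty_fin_num_fun finm)).

Section finite_fubini.
Context d1 d2 (T1 : measurableType d1) (T2 : measurableType d2) (R : realType).
Variables (m1 : {measure set T1 -> \bar R}) (m2 : {measure set T2 -> \bar R}).
Hypothesis fin1 : (m1 setT < +oo)%E.
Hypothesis fin2 : (m2 setT < +oo)%E.
Local Open Scope ereal_scope.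

Let M1 := finite_measure_of fin1.
Let M2 := finite_measure_of fin2.

Variable f : T1 * T2 -> \bar R.
Hypothesis mf : measurable_fun setT f.

Lemma finite_tonelli : (forall z, 0 <= f z) ->
  \int[m1]_x \int[m2]_y f (x, y) = \int[m2]_y \int[m1]_x f (x, y).
Proof. by move=> f0; exact: (@fubini_tonelli _ _ _ _ _ M1 M2 _ mf f0). Qed.

Lemma finite_fubini : \int[m1]_x \int[m2]_y `|f (x, y)| < +oo ->
  \int[m1]_x \int[m2]_y f (x, y) = \int[m2]_y \int[m1]_x f (x, y).
Proof.
move=> foo; apply: (@Fubini _ _ _ _ _ M1 M2).
by apply/integrable12ltyP.
Qed.

(** Reduces a signed iterated integral to nonnegative ones, so that the exchange of variables,
    assumed for nonnegative integrands only, extends to signed kernels. *)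
Lemma finite_fubiniE : \int[m1]_x \int[m2]_y `|f (x, y)| < +oo ->
  \int[m1]_x \int[m2]_y f (x, y) =
  \int[m1]_x \int[m2]_y f^\+ (x, y) - \int[m1]_x \int[m2]_y f^\- (x, y).
Proof.
move=> foo; have fint : (M1 \x M2).-integrable setT f by exact/integrable12ltyP.
rewrite [LHS](integral12_prod_meas1 fint) [LHS]integralE; congr (_ - _).
- by apply: (fubini_tonelli1 (f^\+)) => //; exact: measurable_funepos.
- by apply: (fubini_tonelli1 (f^\-)) => //; exact: measurable_funeneg.
Qed.

(** No integrability enters: the integral is by definition the difference of those of [f^\+] and
    [f^\-], and each of these is measurable in x by the measurability part of Tonelli. *)
Lemma measurable_fun_integral2 : measurable_fun setT (fun x => \int[m2]_y f (x, y)).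
Proof.
rewrite (_ : (fun _ => _) = (fun x => \int[m2]_y f^\+ (x, y)) \-
  (fun x => \int[m2]_y f^\- (x, y))); last first.
  apply/funext => x; rewrite [LHS]integralE /=; congr (_ - _).
    by apply: eq_integral => y _; rewrite -[LHS]/((f \o pair x)^\+ y) funepos_comp.
  by apply: eq_integral => y _; rewrite -[LHS]/((f \o pair x)^\- y) funeneg_comp.
apply: emeasurable_funB.
- apply: (@measurable_fun_fubini_tonelli_F _ _ _ _ _ M2 f^\+) => //.
  exact: measurable_funepos.
- apply: (@measurable_fun_fubini_tonelli_F _ _ _ _ _ M2 f^\-) => //.
  exact: measurable_funeneg.
Qed.

Lemma finite_ae_integrable1 : \int[m1]_x \int[m2]_y `|f (x, y)| < +oo ->
  \forall x \ae m1, m2.-integrable setT (fun y => f (x, y)).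
Proof.
by move=> foo; apply: (@ae_integrable1 _ _ _ _ _ M1 M2); exact/integrable12ltyP.
Qed.

End finite_fubini.

Section ae_lemmas.
Context d (T : measurableType d) (R : realType) (mu : {measure set T -> \bar R}).
Local Open Scope ereal_scope.

Lemma ae_imply (P Q : T -> Prop) : (forall x, P x -> Q x) ->
  (\forall x \ae mu, P x) -> \forall x \ae mu, Q x.
Proof. by move=> PQ; apply: filterS. Qed.

Lemma ae_imply2 (P1 P2 Q : T -> Prop) : (forall x, P1 x -> P2 x -> Q x) ->
  (\forall x \ae mu, P1 x) -> (\forall x \ae mu, P2 x) -> \forall x \ae mu, Q x.
Proof. by move=> PQ; apply: filterS2. Qed.

Lemma ae_imply3 (P1 P2 P3 Q : T -> Prop) : (forall x, P1 x -> P2 x -> P3 x -> Q x) ->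
  (\forall x \ae mu, P1 x) -> (\forall x \ae mu, P2 x) -> (\forall x \ae mu, P3 x) ->
  \forall x \ae mu, Q x.
Proof. by move=> PQ; apply: filterS3. Qed.

Lemma ae_integral_eq0 (f : T -> \bar R) : measurable_fun setT f ->
  (forall x, 0 <= f x) -> \int[mu]_x f x = 0 -> \forall x \ae mu, f x = 0.
Proof.
move=> mf f0 if0.
have /(ae_eq_integral_abs mu measurableT mf) : \int[mu]_x `|f x| = 0.
  by rewrite -if0; apply: eq_integral => x _; rewrite gee0_abs.
by apply: filterS => x; exact.
Qed.

Lemma ae_lty (f : T -> \bar R) : measurable_fun setT f ->
  (forall x, 0 <= f x) -> \int[mu]_x f x < +oo -> \forall x \ae mu, f x < +oo.
Proof.
move=> mf f0 ifoo.
have fint : mu.-integrable setT f.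
  apply/integrableP; split => //.
  by under eq_integral do rewrite gee0_abs//.
have := integrable_ae measurableT fint.
by apply: filterS => x /(_ I); rewrite ge0_fin_numE.
Qed.

Lemma integrable_norm_lty (f : T -> R) : measurable_fun setT f ->
  \int[mu]_x `|f x|%:E < +oo -> mu.-integrable setT (EFin \o f).
Proof. by move=> mf foo; apply/integrableP; split=> //; exact/measurable_EFinP. Qed.

End ae_lemmas.

(** * The space L2 *)

Section L2_functions.
Context d (T : measurableType d) (R : realType) (mu : {measure set T -> \bar R}).

Lemma Lnorm2_sqr (f : T -> R) : measurable_fun setT f ->
  ('N[mu]_2%:E[EFin \o f] `^ 2 = \int[mu]_x (f x ^+ 2)%:E)%E.
Proof.
move=> mf; rewrite powR_Lnorm//; apply: eq_integral => x _ /=.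
by rewrite -(@normr_idP _ (f x ^+ 2) _) ?sqr_ge0// normrX powR_mulrn.
Qed.

Lemma Lfun2P (f : T -> R) : f \in Lfun mu 2%:E <->
  measurable_fun setT f /\ (\int[mu]_x (f x ^+ 2)%:E < +oo)%E.
Proof.
split=> [f2|[mf foo]].
  split; first by move: f2; rewrite inE => /andP[]; rewrite inE.
  exact: integrable_lty (Lfun2_integrable_sqr f2).
rewrite inE; apply/andP; split; rewrite inE//=.
by apply: (@lty_poweRy _ _ 2) => //; rewrite Lnorm2_sqr.
Qed.

Lemma Lspace_Lfun2 (u : LspaceType2 mu) : (u : T -> R) \in Lfun mu 2%:E.
Proof. exact: (LfunP (Lrepr u)). Qed.

Lemma L2norm_ge0 (u : LspaceType2 mu) : 0 <= L2norm u.
Proof. by rewrite fine_ge0// Lnorm_ge0. Qed.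

Lemma L2norm_sqr (u : LspaceType2 mu) : L2norm u ^+ 2 = L2dot u u.
Proof.
have /Lfun2P[mu2 _] := Lspace_Lfun2 u.
have fin : 'N[mu]_2%:E[EFin \o (u : T -> R)]%E \is a fin_num.
  rewrite ge0_fin_numE ?Lnorm_ge0//; have := Lspace_Lfun2 u.
  by rewrite inE => /andP[_]; rewrite inE.
rewrite /L2norm /L2dot /Rintegral.
under eq_integral do rewrite -expr2.
rewrite -Lnorm2_sqr//.
by rewrite -{2}(fineK fin) poweR_EFin /= powR_mulrn// fine_ge0// Lnorm_ge0.
Qed.

Lemma L2dotC (u v : LspaceType2 mu) : L2dot u v = L2dot v u.
Proof. by apply: eq_Rintegral => x _; rewrite mulrC. Qed.

(** Squared norms are plain integrals, to which Tonelli applies directly, and a nonnegative constant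
    lets bounds be multiplied. *)
Definition square_bounded (P : LspaceType2 mu -> LspaceType2 mu) :=
  exists2 C, 0 <= C & forall u, L2dot (P u) (P u) <= C * L2dot u u.

Lemma bounded_operatorP (P : LspaceType2 mu -> LspaceType2 mu) :
  bounded_operator P <-> linear P /\ square_bounded P.
Proof.
split=> -[lP [C]]; last first.
  move=> C0 PC; split=> //; exists (Num.sqrt C) => u.
  rewrite -(@ler_pXn2r _ 2)// ?nnegrE ?mulr_ge0 ?L2norm_ge0 ?sqrtr_ge0//.
  by rewrite exprMn sqr_sqrtr// !L2norm_sqr.
(* [bounded_operator] puts no sign condition on [C], hence the passage through an absolute value. *)
move=> PC; split=> //; exists (C ^+ 2); first exact: sqr_ge0.
move=> u; rewrite -!L2norm_sqr -exprMn.
apply: (@le_trans _ _ (`|C * L2norm u| ^+ 2)); last by rewrite real_normK ?num_real.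
rewrite ler_pXn2r ?nnegrE ?L2norm_ge0//.
exact: le_trans (PC u) (ler_norm _).
Qed.

End L2_functions.

(** * Cauchy-Schwarz for a bounded weight on a finite measure *)

Section cauchy_schwarz.
Context d (T : measurableType d) (R : realType) (nu : {measure set T -> \bar R}).
Hypothesis fin : (nu setT < +oo)%E.

Lemma finite_integrable_cst (c : R) : nu.-integrable setT (EFin \o cst c).
Proof.
exact: (@finite_measure_integrable_cst _ _ _ (finite_measure_of fin)).
Qed.

Lemma Lfun2_integrable (g : T -> R) : g \in Lfun nu 2%:E ->
  nu.-integrable setT (EFin \o g).
Proof.
move=> g2; apply/Lfun1_integrable; apply: (Lfun_subset12 _ g2).
by rewrite ge0_fin_numE.
Qed.

Lemma integrable_bounded_mul (h g : T -> R) (C : R) : measurable_fun setT h ->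
  (forall y, `|h y| <= C) -> nu.-integrable setT (EFin \o g) ->
  nu.-integrable setT (EFin \o (fun y => h y * g y)).
Proof.
move=> mh hC ig.
have mg : measurable_fun setT g by apply/measurable_EFinP; exact: measurable_int ig.
have iCg := integrableZl measurableT C ig.
apply: le_integrable iCg => //.
  by apply/measurable_EFinP; exact: measurable_funM.
move=> y _ /=; rewrite lee_fin !normrM ler_wpM2r//.
exact: le_trans (hC y) (ler_norm _).
Qed.

(** Discriminant argument: with A, B, V the three integrals involved, integrating (h g - t)^2 >= 0
    gives 2 t A <= C^2 B + t^2 V for every real t, and t = A / V is the best choice. *)
Lemma sqr_Rintegral_le (h g : T -> R) (C : R) : measurable_fun setT h ->
  (forall y, `|h y| <= C) -> g \in Lfun nu 2%:E ->
  (\int[nu]_y (h y * g y)) ^+ 2 <=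
    C ^+ 2 * fine (nu setT) * \int[nu]_y (g y ^+ 2).
Proof.
move=> mh hC g2.
have /Lfun2P[mg goo] := g2.
have ig := Lfun2_integrable g2.
have ihg := integrable_bounded_mul mh hC ig.
have ig2 := Lfun2_integrable_sqr g2.
have iag : nu.-integrable setT (EFin \o (fun y => `|h y * g y|)).
  exact: integrable_norm ihg.
set V := fine _; set A := Rintegral _ _ _; set B := Rintegral _ _ _.
have V0 : 0 <= V by rewrite fine_ge0.
have B0 : 0 <= B by apply: Rintegral_ge0 => y _; exact: sqr_ge0.
have key t : 2 * t * A <= C ^+ 2 * B + t ^+ 2 * V.
  have -> : C ^+ 2 * B + t ^+ 2 * V =
      \int[nu]_y (C ^+ 2 * g y ^+ 2 + cst (t ^+ 2) y).
    rewrite RintegralD//; first 1 last.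
    - exact: (integrableZl measurableT (C ^+ 2) ig2).
    - exact: finite_integrable_cst.
    by rewrite RintegralZl// Rintegral_cst.
  rewrite -RintegralZl//; apply: le_Rintegral => //.
  - exact: (integrableZl measurableT (2 * t) ihg).
  - apply: (@integrableD _ _ _ _ _ _ (fun y => (C ^+ 2 * g y ^+ 2)%:E)
      (EFin \o cst (t ^+ 2))) => //.
    + exact: (integrableZl measurableT (C ^+ 2) ig2).
    + exact: finite_integrable_cst.
  move=> y _ /=.
  apply: (@le_trans _ _ ((h y * g y) ^+ 2 + t ^+ 2)).
    rewrite -subr_ge0 (_ : _ - _ = (h y * g y - t) ^+ 2) ?sqr_ge0//.
    by rewrite sqrrB -mulr_natl; ring.
  rewrite lerD2r exprMn ler_wpM2r ?sqr_ge0//.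
  rewrite -(@real_normK _ (h y)) ?num_real//.
  by rewrite ler_pXn2r ?nnegrE//; exact: le_trans (hC y).
(* A / V is meaningless for V = 0, but [nu] is then the zero measure and A vanishes. *)
have [V_eq0|V_neq0] := eqVneq V 0.
  have A_eq0 : A = 0.
    have nuT0 : nu setT = 0%E by rewrite -(@fineK _ (nu setT)) ?ge0_fin_numE// -/V V_eq0.
    by rewrite /A /Rintegral null_set_integral//; exact: measurable_int ihg.
  by rewrite A_eq0 expr0n/= mulr_ge0// mulr_ge0// sqr_ge0.
have V_gt0 : 0 < V by rewrite lt_neqAle eq_sym V_neq0.
have := key (A / V).
rewrite -(ler_pM2r V_gt0) => h1; rewrite -subr_ge0.
rewrite (_ : _ - _ = (C ^+ 2 * B + (A / V) ^+ 2 * V) * V - 2 * (A / V) * A * V).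
  by rewrite subr_ge0.
by field.
Qed.

End cauchy_schwarz.

(** * Coordinates *)

Section finite_Rfubini.
Context d1 d2 (T1 : measurableType d1) (T2 : measurableType d2) (R : realType).
Variables (m1 : {measure set T1 -> \bar R}) (m2 : {measure set T2 -> \bar R}).
Hypothesis fin1 : (m1 setT < +oo)%E.
Hypothesis fin2 : (m2 setT < +oo)%E.
Variable f : T1 * T2 -> R.
Hypothesis mf : measurable_fun setT f.

Let mEf : measurable_fun setT (EFin \o f).
Proof. exact/measurable_EFinP. Qed.

Lemma measurable_fun_Rintegral2 :
  measurable_fun setT (fun x => \int[m2]_y f (x, y)).
Proof.
apply: (measurableT_comp (fine_measurable measurableT)).
exact: (measurable_fun_integral2 fin2 mEf).
Qed.

Hypothesis foo : (\int[m1]_x \int[m2]_y `|f (x, y)|%:E < +oo)%E.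

Lemma ae_integrable_section :
  \forall x \ae m1, m2.-integrable setT (EFin \o (fun y => f (x, y))).
Proof. exact: (finite_ae_integrable1 fin1 fin2 mEf foo). Qed.

(** [fine] loses infinite values, so the real and the extended inner integrals can only be
    identified where the section is integrable. *)
Lemma Rintegral2_ae :
  \forall x \ae m1, (\int[m2]_y f (x, y))%:E = (\int[m2]_y (f (x, y))%:E)%E.
Proof.
apply: filterS ae_integrable_section => x ix.
by rewrite /Rintegral fineK// integrable_fin_num.
Qed.

Lemma integrable_Rintegral2 :
  m1.-integrable setT (EFin \o (fun x => \int[m2]_y f (x, y))).
Proof.
apply: integrable_norm_lty; first exact: measurable_fun_Rintegral2.
apply: le_lt_trans foo; apply: ae_ge0_le_integral => //.
- apply/measurable_EFinP; apply: measurableT_comp => //.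
  exact: measurable_fun_Rintegral2.
- by move=> x _; exact: integral_ge0.
- apply: (measurable_fun_integral2 fin2 (f := fun z => `|f z|%:E)).
  by apply/measurable_EFinP; exact: measurableT_comp.
apply: filterS Rintegral2_ae => x fx _.
rewrite -abse_EFin fx; apply: le_abse_integral => //.
exact: measurable_fun_pair2 mEf.
Qed.

Lemma Rintegral2E : \int[m1]_x \int[m2]_y f (x, y) =
  fine (\int[m1]_x \int[m2]_y (f (x, y))%:E)%E.
Proof.
congr fine; apply: ae_eq_integral => //.
- by apply/measurable_EFinP; exact: measurable_fun_Rintegral2.
- exact: (measurable_fun_integral2 fin2 mEf).
- by apply: filterS Rintegral2_ae => x fx _.
Qed.

End finite_Rfubini.

Lemma finite_Rfubini d1 d2 (T1 : measurableType d1) (T2 : measurableType d2)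
    (R : realType) (m1 : {measure set T1 -> \bar R})
    (m2 : {measure set T2 -> \bar R}) (f : T1 * T2 -> R) :
  (m1 setT < +oo)%E -> (m2 setT < +oo)%E -> measurable_fun setT f ->
  (\int[m1]_x \int[m2]_y `|f (x, y)|%:E < +oo)%E ->
  \int[m1]_x \int[m2]_y f (x, y) = \int[m2]_y \int[m1]_x f (x, y).
Proof.
move=> fin1 fin2 mf foo.
have mEf : measurable_fun setT (EFin \o f) by exact/measurable_EFinP.
have maf : measurable_fun setT (fun z => `|f z|%:E).
  by apply/measurable_EFinP; exact: measurableT_comp.
have mfs : measurable_fun setT (f \o unstable.swap).
  by apply: measurableT_comp => //; exact: measurable_swap.
rewrite (Rintegral2E fin1 fin2 mf foo).
rewrite [RHS](Rintegral2E fin2 fin1 mfs) /=; last first.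
  by rewrite -(finite_tonelli fin1 fin2 maf).
by congr fine; exact: (finite_fubini fin1 fin2 mEf).
Qed.

(** * Slices along one coordinate and null sets *)

Section coordinate.
Context d d' (X : measurableType d) (Y : measurableType d') (R : realType).

(* pr x and sb x y stand for the coordinate x_i of x and for x with x_i replaced
   by y; coord_swap says that (x, y) |-> (sb x y, pr x) preserves mu \x nu. *)
Record coordinate (mu : {measure set X -> \bar R}) (nu : {measure set Y -> \bar R})
    (pr : X -> Y) (sb : X -> Y -> X) : Prop := Coordinate {
  coord_fin1 : (mu setT < +oo)%E;
  coord_fin2 : (nu setT < +oo)%E;
  coord_null : nu setT = 0%E -> mu setT = 0%E;
  coord_mpr : measurable_fun setT pr;
  coord_msb : measurable_fun setT (fun z : X * Y => sb z.1 z.2);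
  coord_prsb : forall x y, pr (sb x y) = y;
  coord_sbsb : forall x y z, sb (sb x y) z = sb x z;
  coord_sbpr : forall x, sb x (pr x) = x;
  coord_swap : forall F : X * Y -> \bar R, measurable_fun setT F ->
    (forall z, (0 <= F z)%E) ->
    (\int[mu]_x \int[nu]_y F (x, y) = \int[mu]_x \int[nu]_y F (sb x y, pr x))%E
}.

Variables (mu : {measure set X -> \bar R}) (nu : {measure set Y -> \bar R}).
Variables (pr : X -> Y) (sb : X -> Y -> X).
Hypothesis co : coordinate mu nu pr sb.

Let fin1 := coord_fin1 co.
Let fin2 := coord_fin2 co.
Let mpr := coord_mpr co.
Let msb := coord_msb co.

Lemma measurable_slice dZ (Z : measurableType dZ) (f : X -> Z) x :
  measurable_fun setT f -> measurable_fun setT (fun y => f (sb x y)).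
Proof.
move=> mf; apply: measurableT_comp => //.
exact: (measurable_fun_pair2 (f := fun z : X * Y => sb z.1 z.2)).
Qed.

Lemma measurable_slices dZ (Z : measurableType dZ) (f : X -> Z) :
  measurable_fun setT f -> measurable_fun setT (fun z : X * Y => f (sb z.1 z.2)).
Proof. by move=> mf; exact: (measurableT_comp mf msb). Qed.

(** This is [coord_swap] for an integrand that ignores its second argument: integrating over all
    replacements of x_i costs a factor equal to the length of the interval. *)
Lemma integral_slices (F : X -> \bar R) : measurable_fun setT F ->
  (forall x, 0 <= F x)%E ->
  (\int[mu]_x \int[nu]_y F (sb x y) = nu setT * \int[mu]_x F x)%E.
Proof.
move=> mF F0; rewrite -(coord_swap co (F := F \o fst)) //=.
  under eq_integral do rewrite integral_cst//.
  under eq_integral do rewrite muleC.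
  by rewrite ge0_integralZl.
by apply: measurableT_comp => //; exact: measurable_fst.
Qed.

(** The indicator of a null set has integral 0, hence by [integral_slices] so do almost all of its
    slices. Applied to a measurable null cover, this asks nothing of [P] itself. *)
Lemma ae_slices (P : X -> Prop) : (\forall x \ae mu, P x) ->
  \forall x \ae mu, \forall y \ae nu, P (sb x y).
Proof.
move=> [N [mN N0 PN]].
have mI : measurable_fun setT (fun x => (\1_N x : R)%:E).
  by apply/measurable_EFinP; exact: measurable_indic.
have : (\int[mu]_x \int[nu]_y (\1_N (sb x y) : R)%:E = 0)%E.
  by rewrite (integral_slices (F := fun x => (\1_N x)%:E))// integral_indic//
    setIT N0 mule0.
move=> int0; have := ae_integral_eq0
  (measurable_fun_integral2 fin2 (measurable_slices mI)) _ int0.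
move=> /(_ _)/wrap[]; first by move=> x; exact: integral_ge0.
apply: filterS => x int0x; have := ae_integral_eq0 (measurable_slice x mI) _ int0x.
move=> /(_ _)/wrap[]; first by move=> y; rewrite lee_fin.
apply: filterS => y [] /eqP; rewrite indicE pnatr_eq0 eqb0 => yN.
by apply: contrapT => nP; move/negP: yN; apply; rewrite inE; exact: PN.
Qed.

Lemma ae_mu0 (P : X -> Prop) : mu setT = 0%E -> \forall x \ae mu, P x.
Proof. by move=> mu0; exists setT; split. Qed.

(** Here [integral_slices] is read backwards: nu setT times the measure of the exceptional set is 0.
    The set has to be measurable for its indicator to be integrated, and when nu setT = 0 the
    conclusion comes from [coord_null] instead. *)
Lemma ae_of_slices (P : X -> Prop) : measurable [set x | ~ P x] ->
  (\forall x \ae mu, \forall y \ae nu, P (sb x y)) -> \forall x \ae mu, P x.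
Proof.
move=> mP aP; have [nu0|nu0] := eqVneq (nu setT) 0%E.
  exact/ae_mu0/(coord_null co nu0).
exists [set x | ~ P x]; split => //.
have mI : measurable_fun setT (fun x => (\1_[set x | ~ P x] x : R)%:E).
  by apply/measurable_EFinP; exact: measurable_indic.
have := integral_slices mI; rewrite integral_indic// setIT => /(_ _)/wrap[].
  by move=> x; rewrite lee_fin.
have -> : (\int[mu]_x \int[nu]_y (\1_[set x | ~ P x] (sb x y))%:E = 0)%E.
  rewrite -[RHS](@integral0 _ _ _ mu setT); apply: ae_eq_integral => //.
    exact: (measurable_fun_integral2 fin2 (measurable_slices mI)).
  apply: filterS aP => x aPx _.
  rewrite -[RHS](@integral0 _ _ _ nu setT); apply: ae_eq_integral => //.
    exact: measurable_slice mI.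
  by apply: filterS aPx => y Py _; rewrite indicE memNset//= => /(_ Py).
by move/esym/eqP; rewrite mule_eq0 (negbTE nu0) => /eqP.
Qed.

(** By [coord_prsb], every slice of the preimage under [pr] of a null set N is N itself. *)
Lemma ae_proj (Q : Y -> Prop) : (\forall y \ae nu, Q y) ->
  \forall x \ae mu, Q (pr x).
Proof.
move=> [N [mN N0 QN]]; have [nu0|nu0] := eqVneq (nu setT) 0%E.
  exact/ae_mu0/(coord_null co nu0).
have mprN : measurable (pr @^-1` N) by rewrite -[X in measurable X]setTI; exact: mpr.
apply: (@filterS _ _ _ (~` (pr @^-1` N))) => [x|].
  by move=> /= xN; apply: contrapT => nQ; apply: xN; exact: QN.
apply: ae_of_slices.
  by rewrite (_ : [set x | _] = pr @^-1` N)//; apply/seteqP; split=> x /=;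
    [exact: contrapT|move=> ? ?].
apply: aeW => x; exists N; split=> // y /=.
by move/contrapT; rewrite (coord_prsb co).
Qed.

Lemma slice_integrable (f : X -> R) : mu.-integrable setT (EFin \o f) ->
  \forall x \ae mu, nu.-integrable setT (EFin \o (fun y => f (sb x y))).
Proof.
move=> /integrableP[/measurable_EFinP mf foo].
apply: (ae_integrable_section fin1 fin2 (measurable_slices mf)).
rewrite /= (integral_slices (F := fun x => `|f x|%:E))//; last first.
  by apply/measurable_EFinP; exact: measurableT_comp.
by rewrite lte_mul_pinfty ?ge0_fin_numE.
Qed.

Lemma slice_Lfun2 (f : X -> R) : f \in Lfun mu 2%:E ->
  \forall x \ae mu, (fun y => f (sb x y)) \in Lfun nu 2%:E.
Proof.
move=> f2; have /Lfun2P[mf foo] := f2.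
apply: filterS (slice_integrable (Lfun2_integrable_sqr f2)) => x ix.
by apply/Lfun2P; split; [exact: measurable_slice|exact: integrable_lty ix].
Qed.

End coordinate.

(** * Kernel operators along a coordinate *)

Section bounded_kernel.
Context d' (Y : measurableType d') (R : realType).

(** Measurability and bounds are required everywhere rather than almost everywhere, so that they
    pass to each single row and column of the kernel. *)
Record bkernel := BKernel {
  bk_mul : Y -> R;
  bk_ker : Y -> Y -> R;
  bk_mmul : measurable_fun setT bk_mul;
  bk_mker : measurable_fun setT (fun z : Y * Y => bk_ker z.1 z.2);
  bk_bounded : exists2 C, 0 <= C &
    (forall y, `|bk_mul y| <= C) /\ (forall y z, `|bk_ker y z| <= C)
}.

Definition bk_bound (w : bkernel) : R := s2val (cid2 (bk_bounded w)).

Lemma bk_bound_ge0 w : 0 <= bk_bound w.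
Proof. exact: (s2valP (cid2 (bk_bounded w))). Qed.

Lemma bk_mul_le w y : `|bk_mul w y| <= bk_bound w.
Proof. exact: (s2valP' (cid2 (bk_bounded w))).1. Qed.

Lemma bk_ker_le w y z : `|bk_ker w y z| <= bk_bound w.
Proof. exact: (s2valP' (cid2 (bk_bounded w))).2. Qed.

Lemma measurable_bk_ker w y : measurable_fun setT (bk_ker w y).
Proof. exact: (measurable_fun_pair2 y (bk_mker w)). Qed.

End bounded_kernel.

Section kernel_operator.
Context d d' (X : measurableType d) (Y : measurableType d') (R : realType).
Variables (mu : {measure set X -> \bar R}) (nu : {measure set Y -> \bar R}).
Variables (pr : X -> Y) (sb : X -> Y -> X).
Implicit Types (w : bkernel Y R) (f g : X -> R).

Definition integral_op w f (x : X) : R := \int[nu]_y (bk_ker w (pr x) y * f (sb x y)).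

Definition kernel_op w f (x : X) : R := bk_mul w (pr x) * f x + integral_op w f x.

Hypothesis co : coordinate mu nu pr sb.

Let fin1 := coord_fin1 co.
Let fin2 := coord_fin2 co.
Let mpr := coord_mpr co.
Let msb := coord_msb co.
Let V := fine (nu setT).

Lemma measurable_integral_op_integrand w f : measurable_fun setT f ->
  measurable_fun setT (fun z : X * Y => bk_ker w (pr z.1) z.2 * f (sb z.1 z.2)).
Proof.
move=> mf; apply: measurable_funM; last exact: (measurable_slices co mf).
have mp : measurable_fun setT (fun z : X * Y => (pr z.1, z.2)).
  apply: measurable_fun_pair; last exact: measurable_snd.
  by apply: measurableT_comp => //; exact: measurable_fst.
exact: (measurableT_comp (bk_mker w) mp).
Qed.

Lemma measurable_mul_pr w : measurable_fun setT (fun x => bk_mul w (pr x)).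
Proof. exact: (measurableT_comp (bk_mmul w)). Qed.

Lemma measurable_integral_op w f : measurable_fun setT f -> measurable_fun setT (integral_op w f).
Proof.
by move=> mf; exact: (measurable_fun_Rintegral2 fin2 (measurable_integral_op_integrand w mf)).
Qed.

Lemma measurable_op w f : measurable_fun setT f -> measurable_fun setT (kernel_op w f).
Proof.
move=> mf; apply: measurable_funD; last exact: measurable_integral_op.
by apply: measurable_funM => //; exact: measurable_mul_pr.
Qed.

Lemma integral_op_integrable w f x : nu.-integrable setT (EFin \o (fun y => f (sb x y))) ->
  nu.-integrable setT (EFin \o (fun y => bk_ker w (pr x) y * f (sb x y))).
Proof.
exact: (integrable_bounded_mul (measurable_bk_ker w (pr x)) (bk_ker_le w (pr x))).
Qed.

(** The 2 comes from (p + q)^2 <= 2 p^2 + 2 q^2 applied to the multiplication and integral parts.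
    The first contributes C^2; the second contributes C^2 V^2, one V from Cauchy-Schwarz and the
    other from [integral_slices]. *)
Definition op_bound w : R := 2 * bk_bound w ^+ 2 * (1 + V ^+ 2).

Lemma op_bound_ge0 w : 0 <= op_bound w.
Proof. 
rewrite /op_bound; apply: mulr_ge0; last by rewrite addr_ge0 ?sqr_ge0.
by rewrite mulr_ge0 ?sqr_ge0.
Qed.

Lemma op_sqr_le w f : f \in Lfun mu 2%:E ->
  (\int[mu]_x (kernel_op w f x ^+ 2)%:E <=
   (op_bound w)%:E * \int[mu]_x (f x ^+ 2)%:E)%E.
Proof.
move=> f2; have /Lfun2P[mf foo] := f2; set C := bk_bound w.
have C0 : 0 <= C ^+ 2 by exact: sqr_ge0.
have V0 : 0 <= V by rewrite fine_ge0.
have D0 : 0 <= 2 * C ^+ 2 by rewrite mulr_ge0.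
have DV0 : 0 <= 2 * C ^+ 2 * V by rewrite mulr_ge0.
have mf2 : measurable_fun setT (fun x => (f x ^+ 2)%:E).
  by apply/measurable_EFinP; exact: measurable_funX.
have mI : measurable_fun setT (fun x => \int[nu]_y (f (sb x y) ^+ 2)%:E)%E.
  exact: (measurable_fun_integral2 fin2 (measurable_slices co mf2)).
have I0 x : (0 <= \int[nu]_y (f (sb x y) ^+ 2)%:E)%E.
  by apply: integral_ge0 => y _; rewrite lee_fin sqr_ge0.
have -> : ((op_bound w)%:E * \int[mu]_x (f x ^+ 2)%:E =
    \int[mu]_x ((2 * C ^+ 2)%:E * (f x ^+ 2)%:E +
      (2 * C ^+ 2 * V)%:E * \int[nu]_y (f (sb x y) ^+ 2)%:E))%E.
  rewrite ge0_integralD//; first last.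
  - exact: measurable_funeM.
  - by move=> x _; rewrite mule_ge0// lee_fin.
  - exact: measurable_funeM.
  - by move=> x _; rewrite -EFinM lee_fin mulr_ge0 ?sqr_ge0.
  rewrite ge0_integralZl_EFin//; last first.
    by move=> x _; rewrite lee_fin sqr_ge0.
  rewrite ge0_integralZl_EFin//.
  rewrite (integral_slices co (F := fun x => (f x ^+ 2)%:E))//; last first.
    by move=> x; rewrite lee_fin sqr_ge0.
  rewrite -(@fineK _ (\int[mu]_x (f x ^+ 2)%:E)%E); last first.
    by rewrite ge0_fin_numE// integral_ge0// => x _; rewrite lee_fin sqr_ge0.
  rewrite -(@fineK _ (nu setT)) ?ge0_fin_numE// -/V -!EFinM -EFinD.
  by congr EFin; rewrite /op_bound -/C; ring.
apply: ae_ge0_le_integral => //.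
- by move=> x _; rewrite lee_fin sqr_ge0.
- by apply/measurable_EFinP; apply: measurable_funX; exact: measurable_op.
- move=> x _; by rewrite adde_ge0// mule_ge0// lee_fin ?sqr_ge0.
- by apply: emeasurable_funD; exact: measurable_funeM.
apply: filterS (slice_Lfun2 co f2) => x fx2 _.
have ix : (\int[nu]_y (f (sb x y) ^+ 2)%:E =
    (\int[nu]_y (f (sb x y) ^+ 2))%:E)%E.
  by rewrite /Rintegral fineK//; apply: integrable_fin_num => //;
    exact: Lfun2_integrable_sqr fx2.
rewrite ix -!EFinM -EFinD lee_fin.
have := sqr_Rintegral_le fin2 (measurable_bk_ker w (pr x)) (bk_ker_le w (pr x)) fx2.
rewrite -/(integral_op w f x) -/V -/C => hK.
apply: (@le_trans _ _ (2 * ((bk_mul w (pr x) * f x) ^+ 2 + integral_op w f x ^+ 2))).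
  rewrite -subr_ge0 /kernel_op (_ : _ - _ = (bk_mul w (pr x) * f x - integral_op w f x) ^+ 2).
    exact: sqr_ge0.
  by ring.
rewrite mulrDr lerD//.
  rewrite -mulrA ler_pM2l// exprMn ler_wpM2r ?sqr_ge0//.
  rewrite -(@real_normK _ (bk_mul _ _)) ?num_real//.
  by rewrite ler_pXn2r ?nnegrE ?bk_bound_ge0// bk_mul_le.
by rewrite -2!(mulrA 2) ler_pM2l.
Qed.

Lemma op_Lfun2 w f : f \in Lfun mu 2%:E -> kernel_op w f \in Lfun mu 2%:E.
Proof.
move=> f2; have /Lfun2P[mf foo] := f2; apply/Lfun2P.
split; first exact: measurable_op.
apply: le_lt_trans (op_sqr_le w f2) _.
rewrite lte_mul_pinfty ?lee_fin ?op_bound_ge0//.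
Qed.

(** This makes [kernel_op] descend to classes: by [ae_slices], the slices of [f] and [g] through
    almost every x agree almost everywhere. *)
Lemma op_ae_eq w f g : measurable_fun setT f -> measurable_fun setT g ->
  (\forall x \ae mu, f x = g x) -> \forall x \ae mu, kernel_op w f x = kernel_op w g x.
Proof.
move=> mf mg fg; apply: filterS2 fg (ae_slices co fg) => x fgx fgy.
rewrite /kernel_op fgx; congr (_ + _); congr fine; apply: ae_eq_integral => //.
- exact: (measurable_fun_pair2 x
    ((measurable_EFinP _ _).2 (measurable_integral_op_integrand w mf))).
- exact: (measurable_fun_pair2 x
    ((measurable_EFinP _ _).2 (measurable_integral_op_integrand w mg))).
- by apply: filterS fgy => y -> _.
Qed.

Lemma op_linear w c f g : mu.-integrable setT (EFin \o f) ->
  mu.-integrable setT (EFin \o g) ->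
  \forall x \ae mu, kernel_op w (fun x => c * f x + g x) x = c * kernel_op w f x + kernel_op w g x.
Proof.
move=> fi gi.
apply: filterS2 (slice_integrable co fi) (slice_integrable co gi) => x fx gx.
have kf := integral_op_integrable w fx; have kg := integral_op_integrable w gx.
rewrite /kernel_op /integral_op.
under eq_Rintegral do rewrite mulrDr mulrCA.
rewrite RintegralD//; last exact: (integrableZl measurableT c kf).
by rewrite RintegralZl//; ring.
Qed.

End kernel_operator.

Lemma eq_Rintegral_ae d (T : measurableType d) (R : realType)
    (mu : {measure set T -> \bar R}) (f g : T -> R) :
  measurable_fun setT f -> measurable_fun setT g ->
  (\forall x \ae mu, f x = g x) -> \int[mu]_x f x = \int[mu]_x g x.
Proof.
move=> mf mg fg; congr fine; apply: ae_eq_integral => //.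
- exact/measurable_EFinP.
- exact/measurable_EFinP.
- by apply: filterS fg => x /= -> _.
Qed.

Lemma ae_eq_Rintegrable d (T : measurableType d) (R : realType)
    (mu : {measure set T -> \bar R}) (f g : T -> R) :
  measurable_fun setT g -> (\forall x \ae mu, f x = g x) ->
  mu.-integrable setT (EFin \o f) -> mu.-integrable setT (EFin \o g).
Proof.
move=> mg fg /integrableP[mf foo]; apply: integrable_norm_lty => //.
rewrite (ae_eq_integral (fun x => `|f x|%:E))//.
- by apply/measurable_EFinP; exact: measurableT_comp mg.
- by apply/measurable_EFinP; apply: measurableT_comp => //; exact/measurable_EFinP.
- by apply: filterS fg => x -> _.
Qed.

(** * Fubini with a bounded weight in each variable *)

Section weighted_fubini.
Context d1 d2 (T1 : measurableType d1) (T2 : measurableType d2) (R : realType).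
Variables (m1 : {measure set T1 -> \bar R}) (m2 : {measure set T2 -> \bar R}).
Hypothesis fin1 : (m1 setT < +oo)%E.
Hypothesis fin2 : (m2 setT < +oo)%E.

Lemma iterated_integral_dominated (F G : T1 * T2 -> R) :
  measurable_fun setT F -> measurable_fun setT G -> (forall z, `|F z| <= G z) ->
  (\int[m1]_x \int[m2]_y (G (x, y))%:E < +oo)%E ->
  (\int[m1]_x \int[m2]_y `|F (x, y)|%:E < +oo)%E.
Proof.
move=> mF mG FG; apply: le_lt_trans.
have mEF : measurable_fun setT (fun z => `|F z|%:E).
  by apply/measurable_EFinP; exact: measurableT_comp.
have mEG : measurable_fun setT (fun z => (G z)%:E) by exact/measurable_EFinP.
have G0 z : 0 <= G z by exact: le_trans (FG z).
apply: ge0_le_integral => //.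
- by move=> x _; exact: integral_ge0.
- exact: (measurable_fun_integral2 fin2 mEF).
- exact: (measurable_fun_integral2 fin2 mEG).
- move=> x _; apply: ge0_le_integral => //.
  + exact: (measurable_fun_pair2 x mEF).
  + exact: (measurable_fun_pair2 x mEG).
  + by move=> y _; rewrite lee_fin.
Qed.

Variables (k1 : T1 -> R) (k2 : T2 -> R) (C1 C2 : R) (h : T1 * T2 -> R).
Hypotheses (mk1 : measurable_fun setT k1) (mk2 : measurable_fun setT k2).
Hypotheses (k1C : forall y, `|k1 y| <= C1) (k2C : forall z, `|k2 z| <= C2).
Hypotheses (mh : measurable_fun setT h).
Hypothesis (hoo : (\int[m1]_x \int[m2]_y `|h (x, y)|%:E < +oo)%E).

Let F z := k1 z.1 * (k2 z.2 * h z).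

Let mF : measurable_fun setT F.
Proof.
apply: measurable_funM.
  by apply: measurableT_comp => //; exact: measurable_fst.
apply: measurable_funM => //.
by apply: measurableT_comp => //; exact: measurable_snd.
Qed.

Let Foo : (\int[m1]_x \int[m2]_y `|F (x, y)|%:E < +oo)%E.
Proof.
have mEh : measurable_fun setT (fun z => `|h z|%:E).
  by apply/measurable_EFinP; exact: measurableT_comp.
apply: (@iterated_integral_dominated F (fun z => `|C1 * C2| * `|h z|)) => //.
- apply: measurable_funM => //; exact: measurableT_comp.
- move=> [x y]; rewrite /F/= !normrM mulrA ler_wpM2r// ler_pM//.
    exact: le_trans (k1C _) (ler_norm _).
  exact: le_trans (k2C _) (ler_norm _).
under eq_integral.
  move=> x _.
  under eq_integral do rewrite EFinM.
  rewrite ge0_integralZl_EFin//; last exact: (measurable_fun_pair2 x mEh).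
  over.
rewrite ge0_integralZl_EFin//.
- by rewrite lte_mul_pinfty ?lee_fin.
- by move=> x _; exact: integral_ge0.
- exact: (measurable_fun_integral2 fin2 mEh).
Qed.

Let innerE :
  \forall x \ae m1, k1 x * (\int[m2]_y (k2 y * h (x, y))) = \int[m2]_y F (x, y).
Proof.
apply: filterS (ae_integrable_section fin1 fin2 mh hoo) => x hx.
by rewrite -RintegralZl//; exact: (integrable_bounded_mul mk2 k2C hx).
Qed.

Let minner : measurable_fun setT (fun x => k1 x * (\int[m2]_y (k2 y * h (x, y)))).
Proof.
apply: measurable_funM => //.
apply: (measurable_fun_Rintegral2 fin2 (f := fun z => k2 z.2 * h z)).
by apply: measurable_funM => //; apply: measurableT_comp => //; exact: measurable_snd.
Qed.

Lemma weighted_Rintegral2E :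
  \int[m1]_x (k1 x * \int[m2]_y (k2 y * h (x, y))) =
  \int[m1]_x \int[m2]_y (k1 x * (k2 y * h (x, y))).
Proof.
by apply: eq_Rintegral_ae => //; exact: (measurable_fun_Rintegral2 fin2 mF).
Qed.

Lemma weighted_integrable :
  m1.-integrable setT (EFin \o (fun x => k1 x * \int[m2]_y (k2 y * h (x, y)))).
Proof.
apply: ae_eq_Rintegrable (integrable_Rintegral2 fin1 fin2 mF Foo) => //.
by apply: filterS innerE => x ->.
Qed.

Lemma weighted_Rfubini : 
  \int[m1]_x \int[m2]_y (k1 x * (k2 y * h (x, y))) =
  \int[m2]_y \int[m1]_x (k1 x * (k2 y * h (x, y))).
Proof. exact: (finite_Rfubini fin1 fin2 mF Foo). Qed.

End weighted_fubini.

(** * Composition of bounded kernels in one variable *)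

Section kernel_composition.
Context d (Y : measurableType d) (R : realType) (nu : {measure set Y -> \bar R}).
Hypothesis fin : (nu setT < +oo)%E.

Lemma bounded_integrable (k : Y -> R) (C : R) : measurable_fun setT k ->
  (forall y, `|k y| <= C) -> nu.-integrable setT (EFin \o k).
Proof.
move=> mk kC.
have := integrable_bounded_mul mk kC (finite_integrable_cst fin 1).
by apply: eq_integrable => // y _ /=; rewrite mulr1.
Qed.

Variables (k1 : Y -> R) (k2 : Y -> Y -> R) (C1 C2 : R) (g : Y -> R).
Hypotheses (mk1 : measurable_fun setT k1)
  (mk2 : measurable_fun setT (fun z : Y * Y => k2 z.1 z.2)).
Hypotheses (k1C : forall y, `|k1 y| <= C1) (k2C : forall y z, `|k2 y z| <= C2).
Hypothesis ig : nu.-integrable setT (EFin \o g).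

Let h (z : Y * Y) := k2 z.1 z.2 * g z.2.

Let mg : measurable_fun setT g.
Proof. by apply/measurable_EFinP; exact: measurable_int ig. Qed.

Let mh : measurable_fun setT h.
Proof.
by apply: measurable_funM => //; apply: measurableT_comp => //; exact: measurable_snd.
Qed.

Let hoo : (\int[nu]_x \int[nu]_y `|h (x, y)|%:E < +oo)%E.
Proof.
have mEg : measurable_fun setT (fun z => `|g z|%:E).
  by apply/measurable_EFinP; exact: measurableT_comp.
apply: (iterated_integral_dominated fin mh (G := fun z => `|C2| * `|g z.2|)).
- apply: measurable_funM => //; apply: measurableT_comp => //.
  by apply: measurableT_comp => //; exact: measurable_snd.
- move=> [x y]; rewrite /h normrM ler_wpM2r//.
  exact: le_trans (k2C _ _) (ler_norm _).
have goo : (\int[nu]_y `|g y|%:E < +oo)%E by case/integrableP : ig.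
rewrite (_ : integral _ _ _ = (`|C2|%:E * \int[nu]_y `|g y|%:E) * nu setT)%E.
  rewrite lte_mul_pinfty ?mule_ge0 ?integral_ge0//.
  by rewrite fin_numM// ge0_fin_numE ?integral_ge0.
rewrite -(integral_cst nu measurableT); apply: eq_integral => x _.
by rewrite -ge0_integralZl_EFin.
Qed.

Let cst1C (z : Y) : `|cst (1 : R) z| <= 1.
Proof. by rewrite normr1. Qed.

Lemma kernel_compE :
  \int[nu]_y (k1 y * \int[nu]_z (k2 y z * g z)) =
  \int[nu]_z ((\int[nu]_y (k1 y * k2 y z)) * g z).
Proof.
(* The weight in z is trivial: k2 y z * g z as a whole is the integrand [h] of the weighted Fubini
   theorem, and k1 is the weight in y. *)
have m1 : measurable_fun setT (cst (1 : R) : Y -> R) by [].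
have := weighted_Rintegral2E fin fin mk1 m1 cst1C mh hoo.
rewrite (weighted_Rfubini fin fin mk1 m1 k1C cst1C mh hoo) /h /=.
under eq_Rintegral do under eq_Rintegral do rewrite mul1r.
move=> ->; apply: eq_Rintegral => z _.
rewrite -RintegralZr//.
  by apply: eq_Rintegral => y _; rewrite mul1r mulrA.
have mk2z : measurable_fun setT (fun y => k2 y z) by exact: (measurable_fun_pair1 z mk2).
exact: (integrable_bounded_mul mk1 k1C (bounded_integrable mk2z (k2C^~ z))).
Qed.

Lemma kernel_comp_integrable :
  nu.-integrable setT (EFin \o (fun y => k1 y * \int[nu]_z (k2 y z * g z))).
Proof.
have m1 : measurable_fun setT (cst (1 : R) : Y -> R) by [].
have := weighted_integrable fin fin mk1 m1 k1C cst1C mh hoo.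
apply: eq_integrable => // y _ /=; congr (_ * _)%:E.
by apply: eq_Rintegral => z _; rewrite mul1r.
Qed.

End kernel_composition.

(** * Composition and adjoints of kernel operators along one coordinate *)

Section operator_algebra.
Context d d' (X : measurableType d) (Y : measurableType d') (R : realType).
Variables (mu : {measure set X -> \bar R}) (nu : {measure set Y -> \bar R}).
Variables (pr : X -> Y) (sb : X -> Y -> X).
Hypothesis co : coordinate mu nu pr sb.
Local Notation kernel_op := (kernel_op nu pr sb).
Local Notation integral_op := (integral_op nu pr sb).

Let fin1 := coord_fin1 co.
Let fin2 := coord_fin2 co.
Let mpr := coord_mpr co.
Let msb := coord_msb co.

(** By [coord_prsb] and [coord_sbsb], applying an operator at a point of the slice through x
    integrates over that same slice, so the claim reduces to composing kernels in one variable. The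
    condition on kernels is almost everywhere because 3-PI kernels may violate it on the
    diagonal. *)
Lemma op_comp (w1 w2 w3 : bkernel Y R) (f : X -> R) :
  (\forall y \ae nu, bk_mul w3 y = bk_mul w1 y * bk_mul w2 y) ->
  (\forall y \ae nu, \forall z \ae nu, bk_ker w3 y z =
     bk_mul w1 y * bk_ker w2 y z + bk_ker w1 y z * bk_mul w2 z +
     \int[nu]_r (bk_ker w1 y r * bk_ker w2 r z)) ->
  mu.-integrable setT (EFin \o f) ->
  \forall x \ae mu, kernel_op w1 (kernel_op w2 f) x = kernel_op w3 f x.
Proof.
move=> hm hk fi.
apply: filterS3 (slice_integrable co fi) (ae_proj co hm) (ae_proj co hk).
move=> x ix hmx hkx; rewrite /kernel_op /= hmx.
set s := pr x in hmx hkx *; pose g y := f (sb x y).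
have mg : measurable_fun setT g by apply/measurable_EFinP; exact: measurable_int ix.
have mk (w : bkernel Y R) : measurable_fun setT (bk_ker w s) by exact: measurable_bk_ker.
have i1 := integrable_bounded_mul (mk w1) (bk_ker_le w1 s)
  (integrable_bounded_mul (bk_mmul w2) (bk_mul_le w2) ix).
have i2 := kernel_comp_integrable fin2 (mk w1) (bk_mker w2) (bk_ker_le w1 s)
  (bk_ker_le w2) ix.
have i3 := integrable_bounded_mul (mk w2) (bk_ker_le w2 s) ix.
have -> : integral_op w1 (kernel_op w2 f) x = \int[nu]_y (bk_ker w1 s y * (bk_mul w2 y * g y)) +
    \int[nu]_z ((\int[nu]_y (bk_ker w1 s y * bk_ker w2 y z)) * g z).
  rewrite -(kernel_compE fin2 (mk w1) (bk_mker w2) (bk_ker_le w1 s) (bk_ker_le w2) ix).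
  rewrite -RintegralD//; apply: eq_Rintegral => y _.
  rewrite /kernel_op /integral_op (coord_prsb co) mulrDr; congr (_ + _ * _).
  by apply: eq_Rintegral => z _; rewrite (coord_sbsb co).
have mK : measurable_fun setT
    (fun z => \int[nu]_y (bk_ker w1 s y * bk_ker w2 y z)).
  apply: (measurable_fun_Rintegral2 fin2
    (f := fun z : Y * Y => bk_ker w1 s z.2 * bk_ker w2 z.2 z.1)).
  apply: measurable_funM.
    by apply: measurableT_comp => //; exact: measurable_snd.
  exact: (measurableT_comp (bk_mker w2) (@measurable_swap _ _ Y Y)).
have -> : integral_op w3 f x = \int[nu]_z (bk_mul w1 s * (bk_ker w2 s z * g z) +
    bk_ker w1 s z * (bk_mul w2 z * g z) +
    (\int[nu]_y (bk_ker w1 s y * bk_ker w2 y z)) * g z).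
  apply: eq_Rintegral_ae.
  - by apply: measurable_funM.
  - apply: measurable_funD; last exact: measurable_funM.
    apply: measurable_funD; do 2?[apply: measurable_funM => //].
    exact: bk_mmul.
  - by apply: filterS hkx => z ->; rewrite -/(g z); ring.
have i4 : nu.-integrable setT (EFin \o
    (fun z => (\int[nu]_y (bk_ker w1 s y * bk_ker w2 y z)) * g z)).
  apply: (integrable_bounded_mul (C := bk_bound w1 * bk_bound w2 * fine (nu setT))) => //.
  move=> z; have mk2z : measurable_fun setT (fun y => bk_ker w2 y z).
    exact: (measurable_fun_pair1 z (bk_mker w2)).
  have i5 := integrable_bounded_mul (mk w1) (bk_ker_le w1 s)
    (bounded_integrable fin2 mk2z (fun y => bk_ker_le w2 y z)).
  apply: le_trans (le_normr_Rintegral measurableT i5) _.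
  rewrite -(Rintegral_cst nu measurableT); apply: le_Rintegral => //.
  - exact: integrable_norm i5.
  - exact: finite_integrable_cst.
  - by move=> y _; rewrite normrM ler_pM// bk_ker_le.
have i3' := integrableZl measurableT (bk_mul w1 s) i3.
rewrite RintegralD//; last exact: (integrableD measurableT i3' i1).
rewrite RintegralD// RintegralZl//.
by rewrite /integral_op -/s -/g; ring.
Qed.

Lemma coord_swap_Rintegral (F : X * Y -> R) : measurable_fun setT F ->
  (\int[mu]_x \int[nu]_y `|F (x, y)|%:E < +oo)%E ->
  (\int[mu]_x \int[nu]_y `|F (sb x y, pr x)|%:E < +oo)%E /\
  \int[mu]_x \int[nu]_y F (x, y) = \int[mu]_x \int[nu]_y F (sb x y, pr x).
Proof.
move=> mF Foo.
pose tau (z : X * Y) := (sb z.1 z.2, pr z.1).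
have mtau : measurable_fun setT tau.
  apply: measurable_fun_pair => //.
  by apply: measurableT_comp => //; exact: measurable_fst.
have mEF : measurable_fun setT (EFin \o F) by exact/measurable_EFinP.
have maF : measurable_fun setT (fun z => `|F z|%:E).
  by apply/measurable_EFinP; exact: measurableT_comp.
have Foo' : (\int[mu]_x \int[nu]_y `|F (sb x y, pr x)|%:E < +oo)%E.
  by rewrite -(coord_swap co maF).
have mFt : measurable_fun setT (F \o tau) by exact: measurableT_comp.
split=> //; rewrite (Rintegral2E fin1 fin2 mF Foo).
rewrite [RHS](Rintegral2E fin1 fin2 mFt Foo').
congr fine.
rewrite (finite_fubiniE fin1 fin2 mEF Foo).
have mEFt : measurable_fun setT (EFin \o (F \o tau)) by exact/measurable_EFinP.
rewrite [RHS](finite_fubiniE fin1 fin2 mEFt Foo').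
rewrite (coord_swap co (measurable_funepos mEF))// (coord_swap co (measurable_funeneg mEF))//.
rewrite -[EFin \o (F \o tau)]/((EFin \o F) \o tau).
by rewrite (funepos_comp (EFin \o F) tau) (funeneg_comp (EFin \o F) tau).
Qed.

(** Provides the absolute convergence behind the adjoint formula: |u v| <= u^2 + v^2 dominates the
    integrand by squares of [f] on slices and of [g], whose integrals are finite by
    [integral_slices]. *)
Lemma integral_op_pairing (w : bkernel Y R) (f g : X -> R) :
  f \in Lfun mu 2%:E -> g \in Lfun mu 2%:E ->
  let F z := bk_ker w (pr z.1) z.2 * f (sb z.1 z.2) * g z.1 in
  [/\ measurable_fun setT F,
      (\int[mu]_x \int[nu]_y `|F (x, y)|%:E < +oo)%E &
      \int[mu]_x (integral_op w f x * g x) = \int[mu]_x \int[nu]_y F (x, y)].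
Proof.
move=> f2 g2 F; have /Lfun2P[mf foo] := f2; have /Lfun2P[mg goo] := g2.
have mgf : measurable_fun setT (fun z : X * Y => g z.1).
  by apply: measurableT_comp => //; exact: measurable_fst.
have mF : measurable_fun setT F.
  by apply: measurable_funM => //; exact: (measurable_integral_op_integrand co w mf).
split=> //.
  pose C := bk_bound w; have C0 : 0 <= C := bk_bound_ge0 w.
  have mf2 : measurable_fun setT (fun x => (f x ^+ 2)%:E).
    by apply/measurable_EFinP; exact: measurable_funX.
  have mg2 : measurable_fun setT (fun x => (g x ^+ 2)%:E).
    by apply/measurable_EFinP; exact: measurable_funX.
  apply: (iterated_integral_dominated fin2 mF
    (G := fun z => C * (f (sb z.1 z.2) ^+ 2 + g z.1 ^+ 2))).
  - apply: measurable_funM => //; apply: measurable_funD; apply: measurable_funX => //.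
    exact: (measurable_slices co mf).
  - move=> [x y]; rewrite /F/= -mulrA normrM ler_pM ?bk_ker_le//.
    set u := f _; set v := g _.
    have : 0 <= (`|u| - `|v|) ^+ 2 by exact: sqr_ge0.
    rewrite sqrrB !real_normK ?num_real// -normrM => h.
    have := normr_ge0 (u * v); rewrite -mulr_natl in h; lra.
  have -> : (\int[mu]_x \int[nu]_y (C * (f (sb x y) ^+ 2 + g x ^+ 2))%:E =
      C%:E * (nu setT * \int[mu]_x (f x ^+ 2)%:E + nu setT * \int[mu]_x (g x ^+ 2)%:E))%E.
    have J0 x : (0 <= \int[nu]_y (f (sb x y) ^+ 2)%:E)%E.
      by apply: integral_ge0 => y _; rewrite lee_fin sqr_ge0.
    rewrite -(integral_slices co mf2); last by move=> x; rewrite lee_fin sqr_ge0.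
    rewrite -ge0_integralZl//; last by move=> x _; rewrite lee_fin sqr_ge0.
    have mJ : measurable_fun setT (fun x => \int[nu]_y (f (sb x y) ^+ 2)%:E)%E.
      exact: (measurable_fun_integral2 fin2 (measurable_slices co mf2)).
    rewrite -ge0_integralD//; last 2 first.
    - by move=> x _; rewrite mule_ge0// lee_fin sqr_ge0.
    - exact: measurable_funeM.
    rewrite -ge0_integralZl_EFin//; last 2 first.
    - by move=> x _; rewrite adde_ge0// mule_ge0// lee_fin sqr_ge0.
    - by apply: emeasurable_funD => //; exact: measurable_funeM.
    apply: eq_integral => x _.
    under eq_integral do rewrite EFinM.
    rewrite ge0_integralZl_EFin//; last 2 first.
    - by move=> y _; rewrite lee_fin addr_ge0 ?sqr_ge0.
    - apply/measurable_EFinP; apply: measurable_funD => //.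
      by apply: measurable_funX; exact: (measurable_slice co).
    congr (_ * _)%E; under eq_integral do rewrite EFinD.
    rewrite ge0_integralD//.
    - by rewrite integral_cst// [X in (_ + X)%E]muleC.
    - by move=> y _; rewrite lee_fin sqr_ge0.
    - exact: (measurable_slice co x mf2).
    - by move=> y _; rewrite lee_fin sqr_ge0.
  have fn : nu setT \is a fin_num by rewrite ge0_fin_numE.
  have ff : (\int[mu]_x (f x ^+ 2)%:E)%E \is a fin_num.
    by rewrite ge0_fin_numE// integral_ge0// => x _; rewrite lee_fin sqr_ge0.
  have fg : (\int[mu]_x (g x ^+ 2)%:E)%E \is a fin_num.
    by rewrite ge0_fin_numE// integral_ge0// => x _; rewrite lee_fin sqr_ge0.
  by rewrite ltey_eq fin_numM ?fin_numD ?fin_numM.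
apply: eq_Rintegral_ae.
- by apply: measurable_funM => //; exact: (measurable_integral_op co).
- exact: (measurable_fun_Rintegral2 fin2 mF).
have fi := Lfun2_integrable fin1 f2.
apply: filterS (slice_integrable co fi) => x ix.
rewrite -RintegralZr//.
exact: (integrable_bounded_mul (measurable_bk_ker w (pr x)) (bk_ker_le w (pr x)) ix).
Qed.

(** The exchange (x, y) |-> (sb x y, pr x) swaps both the two arguments of the kernel and the points
    at which [f] and [g] are evaluated, so it turns one pairing into the other with the kernel
    transposed. *)
Lemma op_adjoint (w w' : bkernel Y R) (f g : X -> R) :
  (forall y, bk_mul w' y = bk_mul w y) ->
  (forall y z, bk_ker w' y z = bk_ker w z y) ->
  f \in Lfun mu 2%:E -> g \in Lfun mu 2%:E ->
  \int[mu]_x (kernel_op w f x * g x) = \int[mu]_x (f x * kernel_op w' g x).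
Proof.
move=> hm hk f2 g2; have /Lfun2P[mf _] := f2; have /Lfun2P[mg _] := g2.
have ifg : mu.-integrable setT (EFin \o (fun x => f x * g x)).
  exact/Lfun1_integrable/Lfun2_mul_Lfun1.
have imfg := integrable_bounded_mul (measurable_mul_pr co w)
  (fun x => bk_mul_le w (pr x)) ifg.
(* The integral part is the whole operator minus its multiplication part, and both of these give
   integrable products. *)
have ik v (a b : X -> R) : a \in Lfun mu 2%:E -> b \in Lfun mu 2%:E ->
    mu.-integrable setT (EFin \o (fun x => integral_op v a x * b x)).
  move=> a2 b2.
  have iab : mu.-integrable setT (EFin \o (fun x => a x * b x)).
    exact/Lfun1_integrable/Lfun2_mul_Lfun1.
  have i1 := integrable_bounded_mul (measurable_mul_pr co v)
    (fun x => bk_mul_le v (pr x)) iab.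
  have i2 : mu.-integrable setT (EFin \o (fun x => kernel_op v a x * b x)).
    by apply/Lfun1_integrable/Lfun2_mul_Lfun1 => //; exact: (op_Lfun2 co).
  have := integrableB measurableT i2 i1.
  by apply: eq_integrable => // x _ /=; rewrite -EFinB /kernel_op; congr EFin; ring.
transitivity (\int[mu]_x (bk_mul w (pr x) * (f x * g x)) + \int[mu]_x (integral_op w f x * g x)).
  rewrite -RintegralD//; last exact: ik.
  by apply: eq_Rintegral => x _; rewrite /kernel_op mulrDl mulrA.
transitivity (\int[mu]_x (bk_mul w (pr x) * (f x * g x)) + \int[mu]_x (integral_op w' g x * f x)).
  congr (_ + _).
  have [mF Foo ->] := integral_op_pairing w f2 g2; have [_ _ ->] := integral_op_pairing w' g2 f2.
  have [_ ->] := coord_swap_Rintegral mF Foo.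
  apply: eq_Rintegral => x _; apply: eq_Rintegral => y _ /=.
  by rewrite (coord_prsb co) (coord_sbsb co) (coord_sbpr co) hk mulrAC.
rewrite -RintegralD//; last exact: ik.
by apply: eq_Rintegral => x _; rewrite /kernel_op hm; ring.
Qed.

End operator_algebra.

(** * Commutation of operators along different coordinates *)

Section operator_commutation.
Context d d1 d2 (X : measurableType d) (Y1 : measurableType d1)
  (Y2 : measurableType d2) (R : realType).
Variables (mu : {measure set X -> \bar R}).
Variables (nu1 : {measure set Y1 -> \bar R}) (nu2 : {measure set Y2 -> \bar R}).
Variables (pr1 : X -> Y1) (sb1 : X -> Y1 -> X) (pr2 : X -> Y2) (sb2 : X -> Y2 -> X).
Hypotheses (co1 : coordinate mu nu1 pr1 sb1) (co2 : coordinate mu nu2 pr2 sb2).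
Hypothesis pr21 : forall x y, pr2 (sb1 x y) = pr2 x.
Hypothesis pr12 : forall x z, pr1 (sb2 x z) = pr1 x.
Hypothesis sb12 : forall x y z, sb2 (sb1 x y) z = sb1 (sb2 x z) y.

Let fin1 := coord_fin2 co1.
Let fin2 := coord_fin2 co2.

Lemma op_commute (w1 : bkernel Y1 R) (w2 : bkernel Y2 R) (f : X -> R) :
  mu.-integrable setT (EFin \o f) ->
  \forall x \ae mu, kernel_op nu1 pr1 sb1 w1 (kernel_op nu2 pr2 sb2 w2 f) x =
                    kernel_op nu2 pr2 sb2 w2 (kernel_op nu1 pr1 sb1 w1 f) x.
Proof.
move=> fi; have /integrableP[/measurable_EFinP mf foo] := fi.
have maf : measurable_fun setT (fun x => `|f x|%:E).
  by apply/measurable_EFinP; exact: measurableT_comp.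
pose H x := (\int[nu2]_z `|f (sb2 x z)|%:E)%E.
have mH : measurable_fun setT H.
  exact: (measurable_fun_integral2 fin2 (measurable_slices co2 maf)).
have H0 x : (0 <= H x)%E by exact: integral_ge0.
(* Two uses of [integral_slices] give the finite total nu1 setT * (nu2 setT * \int |f|). So |f| has
   a finite double integral over the two-dimensional slice through almost every x, where Fubini may
   exchange y and z. *)
have Hoo : \forall x \ae mu, (\int[nu1]_y H (sb1 x y) < +oo)%E.
  apply: ae_lty.
  - exact: (measurable_fun_integral2 fin1 (measurable_slices co1 mH)).
  - by move=> x; exact: integral_ge0.
  - rewrite (integral_slices co1 mH)// (integral_slices co2 maf)//.
    rewrite lte_mul_pinfty ?ge0_fin_numE//.
    by rewrite lte_mul_pinfty ?ge0_fin_numE.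
apply: filterS3 (slice_integrable co1 fi) (slice_integrable co2 fi) Hoo.
move=> x ix1 ix2 Hx.
pose h (z : Y1 * Y2) := f (sb2 (sb1 x z.1) z.2).
have mh : measurable_fun setT h.
  have ms : measurable_fun setT (fun z : Y1 * Y2 => (sb1 x z.1, z.2)).
    apply: measurable_fun_pair; last exact: measurable_snd.
    exact: (measurableT_comp (measurable_slice co1 x (@measurable_id _ X setT))
      measurable_fst).
  exact: (measurableT_comp (measurable_slices co2 mf) ms).
pose s1 := pr1 x; pose s2 := pr2 x.
have mk1 := measurable_bk_ker w1 s1; have mk2 := measurable_bk_ker w2 s2.
have k1C := bk_ker_le w1 s1; have k2C := bk_ker_le w2 s2.
have mhs : measurable_fun setT (h \o @unstable.swap Y2 Y1).
  by apply: measurableT_comp => //; exact: measurable_swap.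
have hsoo : (\int[nu2]_z \int[nu1]_y `|(h \o unstable.swap) (z, y)|%:E < +oo)%E.
  rewrite -(finite_tonelli fin1 fin2 (f := fun z => `|h z|%:E))//.
  by apply/measurable_EFinP; exact: measurableT_comp.
have j1 := integrable_bounded_mul mk1 k1C ix1.
have j2 := integrable_bounded_mul mk2 k2C ix2.
have l1 := weighted_integrable fin1 fin2 mk1 mk2 k1C k2C mh Hx.
have l2 := weighted_integrable fin2 fin1 mk2 mk1 k2C k1C mhs hsoo.
have e1 := weighted_Rintegral2E fin1 fin2 mk1 mk2 k2C mh Hx.
have e2 := weighted_Rintegral2E fin2 fin1 mk2 mk1 k1C mhs hsoo.
have e3 := weighted_Rfubini fin1 fin2 mk1 mk2 k1C k2C mh Hx.
have lhs : integral_op nu1 pr1 sb1 w1 (kernel_op nu2 pr2 sb2 w2 f) x =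
    bk_mul w2 s2 * integral_op nu1 pr1 sb1 w1 f x +
    \int[nu1]_y (bk_ker w1 s1 y * \int[nu2]_z (bk_ker w2 s2 z * h (y, z))).
  rewrite -RintegralZl// -RintegralD//; last first.
    exact: (integrableZl measurableT (bk_mul w2 s2) j1).
  apply: eq_Rintegral => y _; rewrite /kernel_op pr21 mulrDr -/s1 -/s2.
  by rewrite mulrCA /integral_op pr21.
have rhs : integral_op nu2 pr2 sb2 w2 (kernel_op nu1 pr1 sb1 w1 f) x =
    bk_mul w1 s1 * integral_op nu2 pr2 sb2 w2 f x +
    \int[nu2]_z (bk_ker w2 s2 z * \int[nu1]_y (bk_ker w1 s1 y * h (y, z))).
  rewrite -RintegralZl// -RintegralD//; last first.
    exact: (integrableZl measurableT (bk_mul w1 s1) j2).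
  apply: eq_Rintegral => y _; rewrite /kernel_op pr12 mulrDr -/s1 -/s2.
  rewrite mulrCA /integral_op pr12; congr (_ + _ * _).
  by apply: eq_Rintegral => z _; rewrite /h/= sb12.
rewrite /kernel_op lhs rhs e1 e3 [X in _ = _ + (_ + X)]e2.
rewrite (_ : \int[nu2]_x0 \int[nu1]_y _ = \int[nu2]_y \int[nu1]_x0
    (bk_ker w1 s1 x0 * (bk_ker w2 s2 y * h (x0, y)))); last first.
  by apply: eq_Rintegral => z _; apply: eq_Rintegral => y _; rewrite mulrCA.
by rewrite -/s1 -/s2; ring.
Qed.

End operator_commutation.

(** * Kernel operators on classes of square integrable functions *)

Section Lspace_operator.
Context d d' (X : measurableType d) (Y : measurableType d') (R : realType).
Variables (mu : {measure set X -> \bar R}) (nu : {measure set Y -> \bar R}).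

Lemma Lspace_ext (u v : LspaceType2 mu) :
  (\forall x \ae mu, (u x : R) = v x) -> u = v.
Proof. by move=> uv; apply/Lspace_eqP; apply: filterS uv => x. Qed.

Lemma Lspace_linearE c (u v : LspaceType2 mu) :
  \forall x \ae mu, ((c *: u + v : LspaceType2 mu) x : R) = c * u x + v x.
Proof.
by apply: filterS2 (LspaceDE (c *: u) v) (LspaceZE c u) => x /(_ I)/= -> /(_ I)/= ->.
Qed.

Lemma L2dot_ae (u v : LspaceType2 mu) (f g : X -> R) : measurable_fun setT f ->
  measurable_fun setT g -> (\forall x \ae mu, (u x : R) = f x) ->
  (\forall x \ae mu, (v x : R) = g x) -> L2dot u v = \int[mu]_x (f x * g x).
Proof.
move=> mf mg uf vg; have /Lfun2P[mu2 _] := Lspace_Lfun2 u.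
have /Lfun2P[mv2 _] := Lspace_Lfun2 v.
apply: eq_Rintegral_ae; [exact: measurable_funM|exact: measurable_funM|].
by apply: filterS2 uf vg => x -> ->.
Qed.

Variables (pr : X -> Y) (sb : X -> Y -> X).
Hypothesis co : coordinate mu nu pr sb.
Local Notation L2 := (LspaceType2 mu).
Implicit Types (w : bkernel Y R) (u v : L2).

Definition L2_op w u : L2 :=
  Lclass (Lfun_Sub (lee1n 2) (op_Lfun2 co w (Lspace_Lfun2 u))).

Let L2m u : measurable_fun setT (u : X -> R).
Proof. by have /Lfun2P[] := Lspace_Lfun2 u. Qed.

Let L2i u : mu.-integrable setT (EFin \o (u : X -> R)).
Proof. exact: (Lfun2_integrable (coord_fin1 co) (Lspace_Lfun2 u)). Qed.

Lemma OpE w u : \forall x \ae mu, (L2_op w u x : R) = kernel_op nu pr sb w u x.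
Proof.
have := Lclass_ae (Lfun_Sub (lee1n 2) (op_Lfun2 co w (Lspace_Lfun2 u))).
by apply: filterS => x; exact.
Qed.

(** Allows any measurable representative of [u], in particular the explicit formula left by an
    operator applied before. *)
Lemma op_OpE w (u : L2) (f : X -> R) : measurable_fun setT f ->
  (\forall x \ae mu, (u x : R) = f x) ->
  \forall x \ae mu, (L2_op w u x : R) = kernel_op nu pr sb w f x.
Proof.
move=> mf uf; apply: filterS2 (OpE w u) (op_ae_eq co w (L2m u) mf uf) => x.
by move=> -> ->.
Qed.

Lemma Op_linear w : linear (L2_op w).
Proof.
move=> c u v; apply: Lspace_ext.
have mcuv : measurable_fun setT (fun x => c * (u x : R) + v x).
  by apply: measurable_funD => //; exact: measurable_funM.
have h1 : \forall x \ae mu, (L2_op w (c *: u + v) x : R) =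
    c * kernel_op nu pr sb w u x + kernel_op nu pr sb w v x.
  apply: filterS2 (op_OpE w mcuv (Lspace_linearE c u v))
    (op_linear co w c (L2i u) (L2i v)) => x.
  by move=> -> ->.
have h2 : \forall x \ae mu, ((c *: L2_op w u + L2_op w v : L2) x : R) =
    c * kernel_op nu pr sb w u x + kernel_op nu pr sb w v x.
  apply: filterS3 (Lspace_linearE c (L2_op w u) (L2_op w v)) (OpE w u) (OpE w v) => x.
  by move=> -> -> ->.
by apply: filterS2 h1 h2 => x -> ->.
Qed.

Lemma Op_square_bounded w : square_bounded (L2_op w).
Proof.
exists (op_bound nu w); first exact: op_bound_ge0.
move=> u; have m := measurable_op co w (L2m u).
rewrite (L2dot_ae m m (OpE w u) (OpE w u)).
have fin v : (\int[mu]_x ((v x : R) ^+ 2)%:E = (L2dot v v)%:E)%E.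
  rewrite /L2dot /Rintegral fineK; last first.
    exact: (integrable_fin_num measurableT (L2_integrableM v v)).
  by apply: eq_integral => x _; rewrite expr2.
have := op_sqr_le co w (Lspace_Lfun2 u); rewrite fin -EFinM => hle.
rewrite -lee_fin; apply: le_trans hle.
rewrite /Rintegral fineK; last first.
  apply: (integrable_fin_num measurableT); apply/Lfun1_integrable.
  by apply: Lfun2_mul_Lfun1; apply: (op_Lfun2 co); exact: Lspace_Lfun2.
by under [X in (_ <= X)%E]eq_integral do rewrite expr2.
Qed.

Lemma Op_bounded w : bounded_operator (L2_op w).
Proof.
by apply/bounded_operatorP; split; [exact: Op_linear|exact: Op_square_bounded].
Qed.

Lemma Op_comp (w1 w2 w3 : bkernel Y R) :
  (\forall y \ae nu, bk_mul w3 y = bk_mul w1 y * bk_mul w2 y) ->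
  (\forall y \ae nu, \forall z \ae nu, bk_ker w3 y z =
     bk_mul w1 y * bk_ker w2 y z + bk_ker w1 y z * bk_mul w2 z +
     \int[nu]_r (bk_ker w1 y r * bk_ker w2 r z)) ->
  L2_op w1 \o L2_op w2 = L2_op w3.
Proof.
move=> hm hk; apply/funext => u /=; apply: Lspace_ext.
apply: filterS3 (OpE w3 u) (op_OpE w1 (measurable_op co w2 (L2m u)) (OpE w2 u))
  (op_comp co hm hk (L2i u)).
by move=> x -> -> ->.
Qed.

Lemma Op_adjoint w w' : (forall y, bk_mul w' y = bk_mul w y) ->
  (forall y z, bk_ker w' y z = bk_ker w z y) -> is_adjoint (L2_op w) (L2_op w').
Proof.
move=> hm hk; split; first exact: Op_bounded.
move=> u v; have aeR (a : L2) : \forall x \ae mu, (a x : R) = a x by exact: aeW.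
rewrite (L2dot_ae (measurable_op co w (L2m u)) (L2m v) (OpE w u) (aeR v)).
rewrite (L2dot_ae (L2m u) (measurable_op co w' (L2m v)) (aeR u) (OpE w' v)).
exact: (op_adjoint co hm hk (Lspace_Lfun2 u) (Lspace_Lfun2 v)).
Qed.

Lemma Op_id w : (\forall y \ae nu, bk_mul w y = 1) -> (forall y z, bk_ker w y z = 0) ->
  L2_op w = id.
Proof.
move=> hm hk; apply/funext => u; apply: Lspace_ext.
apply: filterS2 (OpE w u) (ae_proj co hm) => x -> hx.
rewrite /kernel_op hx mul1r -[RHS]addr0; congr (_ + _).
transitivity (\int[nu]_(y in setT) (0 : R)); last by rewrite Rintegral_cst// mul0r.
by apply: eq_Rintegral => y _; rewrite hk mul0r.
Qed.

Lemma Op_scale c w w' : (forall y, bk_mul w' y = c * bk_mul w y) ->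
  (forall y z, bk_ker w' y z = c * bk_ker w y z) -> c *: L2_op w = L2_op w'.
Proof.
move=> hm hk; apply/funext => u; apply: Lspace_ext.
rewrite -[(c *: L2_op w) u]/(c *: L2_op w u).
have h1 : \forall x \ae mu, ((c *: L2_op w u : L2) x : R) = c * kernel_op nu pr sb w u x.
  by apply: filterS2 (LspaceZE c (L2_op w u)) (OpE w u) => x /(_ I)/= -> ->.
apply: filterS3 h1 (OpE w' u) (slice_integrable co (L2i u)).
move=> x -> -> ix; rewrite /kernel_op hm mulrDr mulrA; congr (_ + _).
rewrite /integral_op -RintegralZl//; last first.
  exact: (integrable_bounded_mul (measurable_bk_ker w (pr x)) (bk_ker_le w (pr x)) ix).
by apply: eq_Rintegral => y _; rewrite hk mulrA.
Qed.

End Lspace_operator.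

(** * Coordinates of an interval and of a box *)

Section restricted_measure.
Context d (T : measurableType d) (R : realType) (mu : {measure set T -> \bar R}).
Variables (D : set T) (mD : measurable D).
Local Open Scope ereal_scope.

Let muD : {measure set T -> \bar R} := mrestr mu mD.

Lemma ge0_integral_mrestr (f : T -> \bar R) : measurable_fun setT f ->
  (forall x, 0 <= f x) -> \int[muD]_x f x = \int[mu]_(x in D) f x.
Proof.
move=> mf f0; rewrite (@ge0_negligible_integral _ _ _ muD setT (~` D))//.
- rewrite setTD setCK; apply: eq_measure_integral => A mA AD.
  by rewrite /= /mrestr setIidl.
- exact: measurableC.
- by rewrite /= /mrestr setICl measure0.
Qed.

Lemma integral_mrestr (f : T -> \bar R) : measurable_fun setT f ->
  \int[muD]_x f x = \int[mu]_(x in D) f x.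
Proof.
move=> mf; rewrite integralE [RHS]integralE; congr (_ - _);
  rewrite ge0_integral_mrestr//; [exact: measurable_funepos|exact: measurable_funeneg].
Qed.

Lemma ae_mrestr : \forall x \ae muD, D x.
Proof.
exists (~` D); split => //; first exact: measurableC.
by rewrite /= /mrestr setICl measure0.
Qed.

End restricted_measure.

Section coordinates.
Context (R : realType).
Local Notation TR := (measurableTypeR R).
Local Notation leb := (@lebesgue_measure R).

Lemma itv_measureT (a b : R) : a <= b -> itv_measure a b setT = (b - a)%:E.
Proof.
move=> ab; rewrite /= /mrestr setTI [LHS]lebesgue_measure_itv/= lte_fin.
by case: ltgtP ab => // ->; rewrite subrr.
Qed.

Lemma itv_measure_fin (a b : R) : a <= b -> (itv_measure a b setT < +oo)%E.
Proof. by move=> ab; rewrite itv_measureT// ltry. Qed.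

(** With [sb x y = y] the exchange merely renames the two variables of the square, which is
    Tonelli. *)
Lemma coordinate_itv (a b : R) : a <= b ->
  coordinate (itv_measure a b) (itv_measure a b) id (fun _ y => y).
Proof.
move=> ab; have fin := itv_measure_fin ab.
split=> //; first exact: measurable_snd.
by move=> F mF F0; exact: (finite_tonelli fin fin mF F0).
Qed.

Lemma tnth_set_coord N (i : 'I_N) (s : N.-tuple TR) t k :
  tnth (set_coord i s t) k = if k == i then t else tnth s k.
Proof. by rewrite tnth_mktuple. Qed.

Lemma measurable_set_coord N (i : 'I_N) :
  measurable_fun setT (fun z : N.-tuple TR * TR => set_coord i z.1 z.2).
Proof.
apply/measurable_fun_tnthP => k.
rewrite (_ : _ \o _ = fun z => if k == i then z.2 else tnth z.1 k); last first.
  by apply/funext => z /=; rewrite tnth_set_coord.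
case: (k == i); first exact: measurable_snd.
by apply: (measurableT_comp (measurable_tnth k)); exact: measurable_fst.
Qed.

Lemma integral_lebesgue_tupleS n (G : n.+1.-tuple TR -> \bar R) :
  measurable_fun setT G -> (forall s, 0 <= G s)%E ->
  (\int[lebesgue_tuple R n.+1]_s G s =
   \int[leb]_x \int[lebesgue_tuple R n]_s G (cons_pair (x, s)))%E.
Proof.
move=> mG G0.
rewrite [LHS](@ge0_integral_pushforward _ _ _ _ _ (@cons_pair R n)
  (@measurable_cons_pair R n) (leb \x lebesgue_tuple R n)%E setT)//.
rewrite preimage_setT (fubini_tonelli1 (G \o @cons_pair R n))//; last first.
  by move=> z; exact: G0.
by apply: measurableT_comp => //; exact: measurable_cons_pair.
Qed.

Lemma set_coord0 n (x : TR) (s : n.-tuple TR) t :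
  set_coord ord0 (cons_pair (x, s)) t = cons_pair (t, s).
Proof.
apply: eq_from_tnth => k; rewrite tnth_set_coord.
by case: (unliftP ord0 k) => [j ->|->]; rewrite ?eqxx// !tnthS.
Qed.

Lemma set_coordS n (j : 'I_n) (x : TR) (s : n.-tuple TR) t :
  set_coord (lift ord0 j) (cons_pair (x, s)) t = cons_pair (x, set_coord j s t).
Proof.
apply: eq_from_tnth => k; rewrite tnth_set_coord.
case: (unliftP ord0 k) => [l ->|->]; rewrite ?tnthS ?tnth0//.
by rewrite tnth_set_coord (inj_eq (@lift_inj _ ord0)).
Qed.

(** Induction along the recursive construction of the measure. A later coordinate is exchanged
    within the tail. For the first one, the tail is integrated out ([E] below), which leaves Tonelli
    in the plane of the first coordinate and t. *)
Lemma lebesgue_tuple_swap N (i : 'I_N) (F : N.-tuple TR * TR -> \bar R) :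
  measurable_fun setT F -> (forall z, 0 <= F z)%E ->
  (\int[lebesgue_tuple R N]_s \int[leb]_t F (s, t) =
   \int[lebesgue_tuple R N]_s \int[leb]_t F (set_coord i s t, tnth s i))%E.
Proof.
elim: N => [|n ih] in i F *; first by case: i.
move=> mF F0.
have mswap : measurable_fun setT
    (fun z : n.+1.-tuple TR * TR => F (set_coord i z.1 z.2, tnth z.1 i)).
  apply: (measurableT_comp mF); apply: measurable_fun_pair.
    exact: measurable_set_coord.
  by apply: (measurableT_comp (measurable_tnth i)); exact: measurable_fst.
have mL : measurable_fun setT (fun s => \int[leb]_t F (s, t))%E.
  exact: (@measurable_fun_fubini_tonelli_F _ _ _ _ _ leb F).
have mR : measurable_fun setT
    (fun s => \int[leb]_t F (set_coord i s t, tnth s i))%E.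
  by apply: (@measurable_fun_fubini_tonelli_F _ _ _ _ _ leb
    (fun z => F (set_coord i z.1 z.2, tnth z.1 i))).
rewrite (integral_lebesgue_tupleS mL); last by move=> s; exact: integral_ge0.
rewrite (integral_lebesgue_tupleS mR); last by move=> s; exact: integral_ge0.
case: (unliftP ord0 i) => [j ij|i0]; last first.
  pose K (z : (TR * TR) * n.-tuple TR) := F (cons_pair (z.1.1, z.2), z.1.2).
  have mK : measurable_fun setT K.
    apply: (measurableT_comp mF); apply: measurable_fun_pair.
      apply: (measurableT_comp (@measurable_cons_pair R n)).
      apply: measurable_fun_pair; last exact: measurable_snd.
      by apply: (measurableT_comp measurable_fst); exact: measurable_fst.
    by apply: (measurableT_comp measurable_snd); exact: measurable_fst.
  pose E z := (\int[lebesgue_tuple R n]_s K (z, s))%E.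
  have mE : measurable_fun setT E.
    apply: (@measurable_fun_fubini_tonelli_F _ _ _ _ _ (lebesgue_tuple R n) K) => //.
    by move=> z; exact: F0.
  have mKx x : measurable_fun setT (fun z : n.-tuple TR * TR => K ((x, z.2), z.1)).
    apply: (measurableT_comp mK); apply: measurable_fun_pair; last exact: measurable_fst.
    by apply: measurable_fun_pair => //; exact: measurable_snd.
  have mKx' x : measurable_fun setT (fun z : n.-tuple TR * TR => K ((z.2, x), z.1)).
    apply: (measurableT_comp mK); apply: measurable_fun_pair; last exact: measurable_fst.
    by apply: measurable_fun_pair => //; exact: measurable_snd.
  transitivity (\int[leb]_x \int[leb]_t E (x, t))%E.
    apply: eq_integral => x _.
    exact: (@fubini_tonelli _ _ _ _ _ (lebesgue_tuple R n) leb _ (mKx x)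
      (fun z => F0 _)).
  have E0 z : (0 <= E z)%E by apply: integral_ge0 => s _; exact: F0.
  rewrite (@fubini_tonelli _ _ _ _ _ leb leb _ mE E0).
  apply: eq_integral => x _.
  rewrite -[LHS](@fubini_tonelli _ _ _ _ _ (lebesgue_tuple R n) leb _ (mKx' x)
    (fun z => F0 _)).
  apply: eq_integral => s _; apply: eq_integral => t _.
  by rewrite i0 set_coord0 tnth0.
apply: eq_integral => x _.
rewrite (ih j (fun z => F (cons_pair (x, z.1), z.2)))//.
  apply: eq_integral => s _; apply: eq_integral => t _.
  by rewrite ij set_coordS tnthS.
apply: (measurableT_comp mF); apply: measurable_fun_pair; last exact: measurable_snd.
apply: (measurableT_comp (@measurable_cons_pair R n)).
by apply: measurable_fun_pair => //; exact: measurable_fst.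
Qed.

Variables (N : nat) (a b : 'I_N -> R).
Hypothesis ab : forall i, a i <= b i.

Lemma box_measureT : box_measure a b setT = (\prod_(i < N) (b i - a i))%:E.
Proof. by rewrite /= /mrestr setTI lebesgue_tuple_box. Qed.

Lemma box_set_coord (i : 'I_N) (s : N.-tuple TR) t :
  (box a b (set_coord i s t) /\ tnth s i \in `[a i, b i]) <->
  (box a b s /\ t \in `[a i, b i]).
Proof.
split=> -[bs ti]; split.
- move=> k; have := bs k; rewrite tnth_set_coord.
  by case: eqP => // ->.
- by have := bs i; rewrite tnth_set_coord eqxx.
- by move=> k; rewrite tnth_set_coord; case: eqP => [->|_]//; exact: bs.
- exact: bs.
Qed.

(** Moves the restriction from the measures to the integrand. The exchange known for the whole space
    then applies, and by [box_set_coord] it preserves the set to which the integrand is cut off. *)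
Lemma box_integral2 (i : 'I_N) (F : N.-tuple TR * TR -> \bar R) :
  measurable_fun setT F -> (forall z, 0 <= F z)%E ->
  (\int[box_measure a b]_s \int[itv_measure (a i) (b i)]_t F (s, t) =
   \int[lebesgue_tuple R N]_s \int[leb]_t
      (F \_ (box a b `*` [set` `[a i, b i]])) (s, t))%E.
Proof.
move=> mF F0; rewrite ge0_integral_mrestr; last 2 first.
- exact: (measurable_fun_integral2 (itv_measure_fin (ab i)) mF).
- by move=> s; exact: integral_ge0.
rewrite integral_mkcond; apply: eq_integral => s _; rewrite patchE.
case: ifPn => sb; last first.
  rewrite integral0_eq// => t _; rewrite patchE ifF//.
  by apply/negbTE; apply: contra sb; rewrite !inE => -[].
rewrite ge0_integral_mrestr//; last exact: (measurable_fun_pair2 s mF).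
rewrite integral_mkcond; apply: eq_integral => t _; rewrite !patchE.
rewrite (_ : ((s, t) \in _) = (t \in [set` `[a i, b i]]))//.
by rewrite in_setX /= sb.
Qed.

Lemma coordinate_box (i : 'I_N) :
  coordinate (box_measure a b) (itv_measure (a i) (b i))
    (fun s => tnth s i) (set_coord i).
Proof.
split.
- by rewrite box_measureT ltry.
- exact: itv_measure_fin.
- rewrite itv_measureT// box_measureT => -[] /eqP ba0.
  by rewrite (bigD1 i)//= (eqP ba0) mul0r.
- exact: measurable_tnth.
- exact: measurable_set_coord.
- by move=> s t; rewrite tnth_set_coord eqxx.
- move=> s t t'; apply: eq_from_tnth => k; rewrite !tnth_set_coord.
  by case: (k == i).
- by move=> s; apply: eq_from_tnth => k; rewrite tnth_set_coord; case: eqP => [->|].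
move=> F mF F0.
have mF' : measurable_fun setT
    (fun z : N.-tuple TR * TR => F (set_coord i z.1 z.2, tnth z.1 i)).
  apply: (measurableT_comp mF); apply: measurable_fun_pair.
    exact: measurable_set_coord.
  by apply: (measurableT_comp (measurable_tnth i)); exact: measurable_fst.
rewrite box_integral2// [RHS](box_integral2 i mF')//.
have mB : measurable (box a b `*` [set` `[a i, b i]] : set (N.-tuple TR * TR)).
  by apply: measurableX; [exact: measurable_box|exact: measurable_itv].
rewrite (lebesgue_tuple_swap i); last 2 first.
- by apply/(measurable_restrictT _ mB); exact: measurable_funTS.
- by move=> z; rewrite patchE; case: ifP.
apply: eq_integral => s _; apply: eq_integral => t _; rewrite !patchE.
congr (if _ then _ else _); apply/idP/idP; rewrite !inE.
- by move=> [h1 h2]; have [] := (box_set_coord i s t).1 (conj h1 h2).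
- by move=> [h1 h2]; have [] := (box_set_coord i s t).2 (conj h1 h2).
Qed.

Lemma set_coordC (i k : 'I_N) (s : N.-tuple TR) t r : i != k ->
  set_coord k (set_coord i s t) r = set_coord i (set_coord k s r) t.
Proof.
move=> ik; apply: eq_from_tnth => l; rewrite !tnth_set_coord.
by case: eqP => [->|//]; rewrite eq_sym (negbTE ik).
Qed.

End coordinates.

(** * Bivariate polynomials *)

Section bivariate.
Context (R : realType).
Implicit Types (p q : {poly R}) (P Q : {poly {poly R}}).

(** A predicate on functions: kernels obtained by integration are shown polynomial by closure
    properties, without computing coefficients. *)
Definition poly2 (f : R -> R -> R) := exists P, forall s t, f s t = P.[s, t].

Lemma poly2_ext f g : f =2 g -> poly2 f -> poly2 g.
Proof. by move=> fg [P fP]; exists P => s t; rewrite -fg. Qed.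

Lemma poly2_horner P : poly2 (fun s t => P.[s, t]).
Proof. by exists P. Qed.

Lemma poly2_cst c : poly2 (fun _ _ => c).
Proof. by exists c%:P%:P => s t; rewrite !hornerE. Qed.

Lemma poly2_fst p : poly2 (fun s _ => p.[s]).
Proof. by exists (map_poly polyC p) => s t; rewrite horner_map hornerC. Qed.

Lemma poly2_snd p : poly2 (fun _ t => p.[t]).
Proof. by exists p%:P => s t; rewrite hornerC. Qed.

Lemma poly2D f g : poly2 f -> poly2 g -> poly2 (fun s t => f s t + g s t).
Proof. by move=> [P fP] [Q gQ]; exists (P + Q) => s t; rewrite !hornerE fP gQ. Qed.

Lemma poly2M f g : poly2 f -> poly2 g -> poly2 (fun s t => f s t * g s t).
Proof. by move=> [P fP] [Q gQ]; exists (P * Q) => s t; rewrite !hornerE fP gQ. Qed.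

Lemma poly2B f g : poly2 f -> poly2 g -> poly2 (fun s t => f s t - g s t).
Proof.
by move=> [P fP] [Q gQ]; exists (P - Q) => s t; rewrite hornerD hornerN hornerD hornerN fP gQ.
Qed.

Lemma poly2X f n : poly2 f -> poly2 (fun s t => f s t ^+ n).
Proof. by move=> [P fP]; exists (P ^+ n) => s t; rewrite horner_exp horner_exp fP. Qed.

(* The last clause serves to evaluate the antiderivative at end points of
   integration among a, b, s and t. *)
Definition poly_antiderivative (F : R -> R -> R -> R) :=
  exists G : R -> R -> R -> R,
    (forall s t, exists2 q, forall r, q.[r] = G s t r & forall r, q^`().[r] = F s t r) /\
    (forall X, poly2 X -> poly2 (fun s t => G s t (X s t))).

Lemma poly_antiderivative_monomial c n : poly2 c -> poly_antiderivative (fun s t r => c s t * r ^+ n).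
Proof.
move=> c2; exists (fun s t r => c s t * (n.+1%:R^-1 * r ^+ n.+1)); split; last first.
  by move=> X X2; apply: poly2M => //; apply: poly2M (poly2X _ X2); exact: poly2_cst.
move=> s t; exists ((c s t * n.+1%:R^-1) *: 'X^(n.+1)) => r.
  by rewrite hornerZ hornerXn mulrA.
rewrite derivZ derivXn hornerZ hornerMn hornerXn -[r ^+ _ *+ _]mulr_natl.
by rewrite mulrA -(mulrA (c s t)) mulVf ?mulr1// pnatr_eq0.
Qed.

Lemma poly_antiderivativeD F1 F2 : poly_antiderivative F1 -> poly_antiderivative F2 ->
  poly_antiderivative (fun s t r => F1 s t r + F2 s t r).
Proof.
move=> [G1 [H1 X1]] [G2 [H2 X2]]; exists (fun s t r => G1 s t r + G2 s t r); split.
  move=> s t; have [q1 h1 k1] := H1 s t; have [q2 h2 k2] := H2 s t.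
  by exists (q1 + q2) => r; rewrite ?derivD hornerD ?h1 ?h2 ?k1 ?k2.
by move=> X pX; apply: poly2D; [exact: X1|exact: X2].
Qed.

Lemma poly_antiderivative_sum n (F : 'I_n -> R -> R -> R -> R) :
  (forall i, poly_antiderivative (F i)) -> poly_antiderivative (fun s t r => \sum_(i < n) F i s t r).
Proof.
elim: n F => [|n ih] F iF.
  have := poly_antiderivative_monomial 0 (poly2_cst 0).
  by congr poly_antiderivative; apply/funext => s; apply/funext => t; apply/funext => r;
    rewrite big_ord0 mul0r.
have := poly_antiderivativeD (ih (fun i => F (widen_ord (leqnSn n) i)) (fun i => iF _))
  (iF ord_max).
by congr poly_antiderivative; apply/funext => s; apply/funext => t; apply/funext => r;
  rewrite big_ord_recr.
Qed.

(** Expanded in powers of r, the product is a finite sum of terms c(s, t) r^n with c polynomial. *)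
Lemma poly_antiderivative_product P Q : poly_antiderivative (fun s t r => P.[s, r] * Q.[r, t]).
Proof.
have -> : (fun s t r => P.[s, r] * Q.[r, t]) = (fun s t r =>
    \sum_(i < size P) \sum_(j < size P`_i) \sum_(k < size Q)
      (P`_i`_j * ('X^i).[s] * (Q`_k).[t]) * r ^+ (j + k)).
  apply/funext => s; apply/funext => t; apply/funext => r.
  rewrite (horner_coef P) horner_sum mulr_suml; apply: eq_bigr => i _.
  rewrite -polyC_exp hornerM hornerC (horner_coef P`_i) mulr_suml mulr_suml.
  apply: eq_bigr => j _; rewrite (horner_coef Q) horner_sum mulr_sumr.
  apply: eq_bigr => k _; rewrite -polyC_exp hornerM hornerC hornerXn exprD.
  by ring.
do 3!(apply: poly_antiderivative_sum => ?); apply: poly_antiderivative_monomial.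
apply: poly2M; last exact: poly2_snd.
by apply: poly2M; [exact: poly2_cst|exact: poly2_fst].
Qed.

Lemma Rintegral_deriv q (c e : R) : c <= e ->
  \int[lebesgue_measure]_(r in `[c, e]) q^`().[r] = q.[e] - q.[c].
Proof.
rewrite le_eqVlt => /predU1P[->|ce].
  by rewrite subrr set_itv1 Rintegral_set1.
rewrite /Rintegral (@continuous_FTC2 _ (horner q^`()) (horner q))//.
- by apply: continuous_subspaceT => x; exact: continuous_horner.
- split.
  + by move=> x _; exact: derivable_horner.
  + by apply: cvg_at_right_filter; exact: continuous_horner.
  + by apply: cvg_at_left_filter; exact: continuous_horner.
- by move=> x _; rewrite -derivE.
Qed.

Lemma bounded_horner p (M : R) : exists2 C, 0 <= C & forall x, `|x| <= M -> `|p.[x]| <= C.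
Proof.
elim/poly_ind: p => [|p c [C C0 ih]]; first by exists 0 => // x _; rewrite horner0 normr0.
exists (C * `|M| + `|c|); first by rewrite addr_ge0 ?mulr_ge0.
move=> x xM; rewrite hornerMXaddC (le_trans (ler_normD _ _))// lerD2r normrM.
by rewrite ler_pM// ?ih// (le_trans xM)// ler_norm.
Qed.

Lemma bounded_horner2 P (M : R) : exists2 C, 0 <= C &
  forall x y, `|x| <= M -> `|y| <= M -> `|P.[x, y]| <= C.
Proof.
elim/poly_ind: P => [|P c [C C0 ih]].
  by exists 0 => // x y _ _; rewrite !horner0 normr0.
have [D D0 cD] := bounded_horner c M.
exists (C * `|M| + D); first by rewrite addr_ge0 ?mulr_ge0.
move=> x y xM yM; rewrite hornerMXaddC hornerD hornerM hornerC.
rewrite (le_trans (ler_normD _ _))// lerD ?cD// normrM.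
by rewrite ler_pM// ?ih// (le_trans xM)// ler_norm.
Qed.

Lemma measurable_horner p : measurable_fun setT (horner p : R -> R).
Proof.
elim/poly_ind: p => [|p c ih].
  by rewrite (_ : horner 0 = cst 0)//; apply/funext => x; rewrite horner0.
rewrite (_ : horner _ = fun x => p.[x] * x + c).
  by apply: measurable_funD => //; exact: measurable_funM.
by apply/funext => x; rewrite hornerMXaddC.
Qed.

Lemma measurable_horner2 P : measurable_fun setT (fun z : R * R => P.[z.1, z.2]).
Proof.
elim/poly_ind: P => [|P c ih].
  rewrite (_ : (fun _ => _) = cst 0)//; apply/funext => x; by rewrite !horner0.
rewrite (_ : (fun _ => _) = fun z => P.[z.1, z.2] * z.1 + c.[z.2]).
  apply: measurable_funD.
    by apply: measurable_funM => //; exact: measurable_fst.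
  by apply: (measurableT_comp (measurable_horner c)); exact: measurable_snd.
by apply/funext => x; rewrite hornerMXaddC hornerD hornerM hornerC.
Qed.

End bivariate.

(** * Symbols of 3-PI operators *)

Section symbol.
Context (R : realType).
Local Notation TR := (measurableTypeR R).
Local Notation leb := (@lebesgue_measure R).

(* The parameters P_0, P_1, P_2 of a 3-PI operator. *)
Record symbol := Symbol {
  sym0 : {poly R};
  sym1 : {poly {poly R}};
  sym2 : {poly {poly R}}
}.

Variables (a b : R).
Hypothesis ab : a <= b.
Local Notation nu := (itv_measure a b).

(** The cut-off makes the polynomial bounded on the whole line, as [bkernel] demands, and changes it
    only on a null set of [nu]. *)
Definition sym_mul (w : symbol) (y : TR) : R :=
  if y \in `[a, b] then (sym0 w).[y] else 0.

(* The value 0 on the diagonal makes the kernel of the transposed symbol the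
   exact transpose of the kernel. *)
Definition sym_ker (w : symbol) (y z : TR) : R :=
  if (y \in `[a, b]) && (z \in `[a, b]) then
    if z < y then (sym1 w).[y, z] else if y < z then (sym2 w).[y, z] else 0
  else 0.

Let M := `|a| + `|b|.

Let itv_norm (y : R) : y \in `[a, b] -> `|y| <= M.
Proof.
rewrite in_itv/= => /andP[ay yb]; rewrite ler_norml /M.
have := ler_norm b; have := ler_norm (- a); rewrite normrN.
have := normr_ge0 a; have := normr_ge0 b.
by move=> ? ? ? ?; apply/andP; split; lra.
Qed.

Let measurable_in_itv d (T : measurableType d) (f : T -> R) : measurable_fun setT f ->
  measurable_fun setT (fun x => f x \in `[a, b]).
Proof.
move=> mf; rewrite (_ : (fun _ => _) = fun x => (a <= f x) && (f x <= b)).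
  by apply: measurable_and; exact: measurable_fun_ler.
by apply/funext => x; rewrite in_itv.
Qed.

Lemma measurable_sym_mul w : measurable_fun setT (sym_mul w).
Proof.
apply: measurable_fun_ifT => //; last exact: measurable_horner.
exact: measurable_in_itv.
Qed.

Lemma measurable_sym_ker w :
  measurable_fun setT (fun z : TR * TR => sym_ker w z.1 z.2).
Proof.
have m1 : measurable_fun setT (@fst TR TR) by exact: measurable_fst.
have m2 : measurable_fun setT (@snd TR TR) by exact: measurable_snd.
apply: measurable_fun_ifT => //.
  by apply: measurable_and; exact: measurable_in_itv.
apply: measurable_fun_ifT; first exact: measurable_fun_ltr.
  exact: measurable_horner2.
apply: measurable_fun_ifT => //; first exact: measurable_fun_ltr.
exact: measurable_horner2.
Qed.

Lemma sym_bounded w : exists2 C, 0 <= C &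
  (forall y, `|sym_mul w y| <= C) /\ (forall y z, `|sym_ker w y z| <= C).
Proof.
have [C0 C00 h0] := bounded_horner (sym0 w) M.
have [C1 C10 h1] := bounded_horner2 (sym1 w) M.
have [C2 C20 h2] := bounded_horner2 (sym2 w) M.
exists (C0 + C1 + C2); first by rewrite !addr_ge0.
split=> [y|y z]; rewrite /sym_mul /sym_ker.
  case: ifPn => yI; last by rewrite normr0 !addr_ge0.
  by have := h0 _ (itv_norm yI) => h; lra.
case: ifPn => [/andP[yI zI]|_]; last by rewrite normr0 !addr_ge0.
case: ifPn => _; first by have := h1 _ _ (itv_norm yI) (itv_norm zI) => h; lra.
case: ifPn => _; first by have := h2 _ _ (itv_norm yI) (itv_norm zI) => h; lra.
by rewrite normr0 !addr_ge0.
Qed.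

Definition sym_bk (w : symbol) : bkernel TR R :=
  BKernel (measurable_sym_mul w) (measurable_sym_ker w) (sym_bounded w).

Lemma ae_itv : \forall y \ae nu, y \in `[a, b].
Proof. exact: (ae_mrestr leb (measurable_itv `[a, b])). Qed.

Lemma ae_itv_neq (u : R) : \forall y \ae nu, y != u.
Proof.
exists [set u]; split; first exact: measurable_set1.
  apply/eqP; rewrite -measure_le0 -(@lebesgue_measure_set1 R u).
  apply: le_measure; rewrite ?inE//; first exact: measurableI.
by move=> y /= /negP; rewrite negbK => /eqP.
Qed.

Lemma integrable_poly_mul (p : {poly R}) (v : TR -> R) :
  nu.-integrable setT (EFin \o v) ->
  nu.-integrable setT (EFin \o (fun t => p.[t] * v t)).
Proof.
(* [sym_mul w] is [p] cut off to [a, b]: bounded, and equal to [p] almost everywhere. *)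
move=> iv; pose w := Symbol p 0 0.
have mv : measurable_fun setT v by apply/measurable_EFinP; exact: measurable_int iv.
apply: ae_eq_Rintegrable (integrable_bounded_mul (measurable_sym_mul w)
  (bk_mul_le (sym_bk w)) iv).
  by apply: measurable_funM => //; exact: measurable_horner.
by apply: ae_imply ae_itv => t tI; rewrite /sym_mul tI.
Qed.

Lemma integrable_patch (g : TR -> R) (J : set TR) : measurable J ->
  nu.-integrable setT (EFin \o g) -> nu.-integrable setT (EFin \o (g \_ J)).
Proof.
move=> mJ ig.
have mg : measurable_fun setT g by apply/measurable_EFinP; exact: measurable_int ig.
apply: le_integrable ig => //.
  apply/measurable_EFinP; apply/(measurable_restrictT _ mJ).
  exact: measurable_funTS.
by move=> x _ /=; rewrite lee_fin patchE; case: ifP => // _; rewrite normr0.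
Qed.

Lemma itv_Rintegral_patch (g : TR -> R) (c e : R) : measurable_fun setT g ->
  a <= c -> e <= b ->
  \int[nu]_t (g \_ `[c, e]) t = \int[leb]_(t in `[c, e]) g t.
Proof.
move=> mg ac eb; have mJ : measurable (`[c, e]%classic : set TR) by exact: measurable_itv.
have mp : measurable_fun setT (g \_ `[c, e]).
  by apply/(measurable_restrictT _ mJ); exact: measurable_funTS.
transitivity (\int[leb]_(t in `[a, b]) (g \_ `[c, e]) t).
  congr fine; apply: integral_mrestr; exact/measurable_EFinP.
rewrite -Rintegral_mkcondr; congr (Rintegral _ _ _).
by apply/setIidr => x /=; rewrite !in_itv/= => /andP[cx xe];
  rewrite (le_trans ac cx) (le_trans xe eb).
Qed.

(** Serves integrands whose formula changes at u and v. The break points are null, so nothing is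
    asked of [h] there, and u = v covers a single change of formula. *)
Lemma itv_Rintegral_pieces (h g1 g2 g3 : TR -> R) (u v : R) :
  a <= u -> u <= v -> v <= b -> measurable_fun setT h ->
  nu.-integrable setT (EFin \o g1) -> nu.-integrable setT (EFin \o g2) ->
  nu.-integrable setT (EFin \o g3) ->
  (forall r, r \in `[a, b] -> r < u -> h r = g1 r) ->
  (forall r, r \in `[a, b] -> u < r -> r < v -> h r = g2 r) ->
  (forall r, r \in `[a, b] -> v < r -> h r = g3 r) ->
  \int[nu]_r h r = \int[leb]_(r in `[a, u]) g1 r +
    \int[leb]_(r in `[u, v]) g2 r + \int[leb]_(r in `[v, b]) g3 r.
Proof.
move=> au uv vb mh i1 i2 i3 h1 h2 h3.
have mI g : nu.-integrable setT (EFin \o g) -> measurable_fun setT g.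
  by move=> ig; apply/measurable_EFinP; exact: measurable_int ig.
have mitv (c e : R) : measurable (`[c, e]%classic : set TR) by exact: measurable_itv.
have [p1 p2 p3] := And3 (integrable_patch (mitv a u) i1)
  (integrable_patch (mitv u v) i2) (integrable_patch (mitv v b) i3).
rewrite -(itv_Rintegral_patch (mI _ i1) (lexx a) (le_trans uv vb)).
rewrite -(itv_Rintegral_patch (mI _ i2) au vb).
rewrite -(itv_Rintegral_patch (mI _ i3) (le_trans au uv) (lexx b)).
have p12 := integrableD measurableT p1 p2.
rewrite -RintegralD// -RintegralD//.
apply: eq_Rintegral_ae => //.
  apply: measurable_funD; last exact: mI.
  by apply: measurable_funD; exact: mI.
apply: ae_imply3 ae_itv (ae_itv_neq u) (ae_itv_neq v) => r rI ru rv.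
have /andP[ar rb] : (a <= r) && (r <= b) by move: rI; rewrite in_itv.
rewrite !patchE !mem_setE !in_itv/= ar rb !andbT/=.
have [{}ru|{}ru|re] := ltgtP r u; last by rewrite re eqxx in ru.
  have rv' := lt_le_trans ru uv.
  by rewrite (leNgt v) rv' /= !addr0 h1.
have [{}rv|{}rv|re] := ltgtP r v; last by rewrite re eqxx in rv.
  by rewrite /= add0r addr0 h2.
by rewrite /= !add0r h3.
Qed.

Lemma op_symE (w : symbol) (v : TR -> R) s : nu.-integrable setT (EFin \o v) ->
  s \in `[a, b] ->
  kernel_op nu id (fun _ y => y) (sym_bk w) v s = (sym0 w).[s] * v s +
    \int[leb]_(t in `[a, s]) ((sym1 w).[s, t] * v t) +
    \int[leb]_(t in `[s, b]) ((sym2 w).[s, t] * v t).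
Proof.
move=> iv sI; rewrite /kernel_op /= /sym_mul sI -addrA; congr (_ + _).
have /andP[as_ sb] : (a <= s) && (s <= b) by move: sI; rewrite in_itv.
have mv : measurable_fun setT v by apply/measurable_EFinP; exact: measurable_int iv.
(* There is one break point: with u = v = s the middle interval is a single point, and the zero
   polynomial fills its place. *)
rewrite /integral_op (@itv_Rintegral_pieces _ (fun t => (sym1 w).[s, t] * v t)
  (fun t => 0%:P.[t] * v t) (fun t => (sym2 w).[s, t] * v t) s s)//.
- by rewrite set_itv1 Rintegral_set1 addr0.
- apply: measurable_funM => //.
  exact: (measurable_fun_pair2 s (measurable_sym_ker w)).
- exact: integrable_poly_mul.
- exact: integrable_poly_mul.
- exact: integrable_poly_mul.
- by move=> t tI ts; rewrite /= /sym_ker sI tI ts.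
- by move=> t tI st ts; have := lt_trans st ts; rewrite ltxx.
- by move=> t tI st; rewrite /= /sym_ker sI tI st /= ltNge (ltW st).
Qed.

(** In \int k1(y, r) k2(r, z) dr the formulas change at r = y and r = z. Below both, the integrand
    is P1 Q2; above both, P2 Q1; between them, P1 Q1 if z < y and P2 Q2 if y < z. Each piece
    integrates to a polynomial in (y, z), and the pieces are the same throughout either side of the
    diagonal; hence the four antiderivatives and the two polynomials [S1] and [S2]. *)
Lemma sym_comp (w1 w2 : symbol) : exists w3 : symbol,
  (forall y, sym_mul w3 y = sym_mul w1 y * sym_mul w2 y) /\
  (\forall y \ae nu, \forall z \ae nu, sym_ker w3 y z =
     sym_mul w1 y * sym_ker w2 y z + sym_ker w1 y z * sym_mul w2 z +
     \int[nu]_r (sym_ker w1 y r * sym_ker w2 r z)).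
Proof.
case: w1 w2 => [p P1 P2] [q Q1 Q2].
have [G12 [H12 S12]] := poly_antiderivative_product P1 Q2.
have [G11 [H11 S11]] := poly_antiderivative_product P1 Q1.
have [G21 [H21 S21]] := poly_antiderivative_product P2 Q1.
have [G22 [H22 S22]] := poly_antiderivative_product P2 Q2.
have pX : poly2 (fun s _ : R => s).
  by have := poly2_fst ('X : {poly R}); apply: poly2_ext => s t; rewrite hornerX.
have pY : poly2 (fun _ t : R => t).
  by have := poly2_snd ('X : {poly R}); apply: poly2_ext => s t; rewrite hornerX.
have [S1 hS1] : poly2 (fun y z => p.[y] * Q1.[y, z] + P1.[y, z] * q.[z] +
    ((G12 y z z - G12 y z a) + (G11 y z y - G11 y z z) + (G21 y z b - G21 y z y))).
  apply: poly2D.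
    by apply: poly2D; apply: poly2M;
      [exact: poly2_fst|exact: poly2_horner|exact: poly2_horner|exact: poly2_snd].
  by apply: poly2D; [apply: poly2D|]; apply: poly2B;
    do ?[exact: (S12 _ pX)|exact: (S12 _ pY)|exact: (S11 _ pX)|exact: (S11 _ pY)
      |exact: (S21 _ pX)|exact: (S12 _ (poly2_cst a))|exact: (S21 _ (poly2_cst b))].
have [S2 hS2] : poly2 (fun y z => p.[y] * Q2.[y, z] + P2.[y, z] * q.[z] +
    ((G12 y z y - G12 y z a) + (G22 y z z - G22 y z y) + (G21 y z b - G21 y z z))).
  apply: poly2D.
    by apply: poly2D; apply: poly2M;
      [exact: poly2_fst|exact: poly2_horner|exact: poly2_horner|exact: poly2_snd].
  by apply: poly2D; [apply: poly2D|]; apply: poly2B;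
    do ?[exact: (S12 _ pX)|exact: (S22 _ pX)|exact: (S22 _ pY)|exact: (S21 _ pY)
      |exact: (S12 _ (poly2_cst a))|exact: (S21 _ (poly2_cst b))].
have piece (P Q : {poly {poly R}}) G (c e y z : R) : c <= e ->
    (forall s t, exists2 q : {poly R}, forall r, q.[r] = G s t r &
      forall r, q^`().[r] = P.[s, r] * Q.[r, t]) ->
    \int[leb]_(r in `[c, e]) (P.[y, r] * Q.[r, z]) = G y z e - G y z c.
  move=> ce /(_ y z)[g gG gF]; rewrite -!gG -(Rintegral_deriv _ ce).
  by apply: eq_Rintegral => r _; rewrite gF.
have integrable_PQ (P Q : {poly {poly R}}) (y z : R) :
    nu.-integrable setT (EFin \o (fun r : TR => P.[y, r] * Q.[r, z])).
  (* In r alone this is a polynomial: P with its outer variable set to y, times Q with its inner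
     variable set to z. *)
  have i1 := integrable_poly_mul (P.[y%:P] * (swapXY Q).[z%:P])
    (finite_integrable_cst (itv_measure_fin ab) 1).
  apply: eq_integrable i1 => // r _ /=.
  by rewrite mulr1 hornerM horner2_swapXY.
exists (Symbol (p * q) S1 S2); split=> [y|].
  by rewrite /sym_mul/=; case: ifP => _; rewrite ?mul0r// hornerM.
apply: ae_imply ae_itv => y yI.
(* On the diagonal [sym_ker] is 0 by convention while the composed kernel need not be, so z = y is
   discarded as a null set. *)
apply: ae_imply2 ae_itv (ae_itv_neq y) => z zI zy.
have /andP[ay yb] : (a <= y) && (y <= b) by move: yI; rewrite in_itv.
have /andP[az zb] : (a <= z) && (z <= b) by move: zI; rewrite in_itv.
have mh : measurable_fun setT
    (fun r : TR => sym_ker (Symbol p P1 P2) y r * sym_ker (Symbol q Q1 Q2) r z).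
  apply: measurable_funM.
    exact: (measurable_fun_pair2 y (measurable_sym_ker _)).
  exact: (measurable_fun_pair1 z (measurable_sym_ker _)).
have [zly|ylz|zE] := ltgtP z y; last by rewrite zE eqxx in zy.
- rewrite {1 2 3}/sym_ker /sym_mul yI zI zly /= -hS1; congr (_ + _).
  rewrite (itv_Rintegral_pieces az (ltW zly) yb mh (integrable_PQ P1 Q2 y z)
    (integrable_PQ P1 Q1 y z) (integrable_PQ P2 Q1 y z)).
  + by rewrite !(piece _ _ _ _ _ _ _ _ H12, piece _ _ _ _ _ _ _ _ H11,
      piece _ _ _ _ _ _ _ _ H21)// ltW.
  + move=> r rI rz; rewrite /sym_ker yI rI zI /= (lt_trans rz zly) rz.
    by rewrite ltNge (ltW rz).
  + by move=> r rI zr ry; rewrite /sym_ker yI rI zI /= ry zr.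
  + move=> r rI yr; rewrite /sym_ker yI rI zI /= yr (lt_trans zly yr).
    by rewrite ltNge (ltW yr).
- rewrite {1 2 3}/sym_ker /sym_mul yI zI ltNge (ltW ylz) ylz /= -hS2; congr (_ + _).
  rewrite (itv_Rintegral_pieces ay (ltW ylz) zb mh (integrable_PQ P1 Q2 y z)
    (integrable_PQ P2 Q2 y z) (integrable_PQ P2 Q1 y z)).
  + by rewrite !(piece _ _ _ _ _ _ _ _ H12, piece _ _ _ _ _ _ _ _ H22,
      piece _ _ _ _ _ _ _ _ H21)// ltW.
  + move=> r rI ry; have rz := lt_trans ry ylz.
    by rewrite /sym_ker yI rI zI /= ry rz ltNge (ltW rz).
  + move=> r rI yr rz; rewrite /sym_ker yI rI zI /= yr rz.
    by rewrite !ltNge (ltW yr) (ltW rz).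
  + move=> r rI zr; have yr := lt_trans ylz zr.
    by rewrite /sym_ker yI rI zI /= zr yr ltNge (ltW yr).
Qed.

(** Transposition reflects the square in its diagonal, so the two kernels change places besides
    exchanging their variables. *)
Definition sym_tr (w : symbol) := Symbol (sym0 w) (swapXY (sym2 w)) (swapXY (sym1 w)).

Lemma sym_trE w y z : sym_ker (sym_tr w) y z = sym_ker w z y.
Proof.
rewrite /sym_ker /= andbC; case: ifP => // _.
by rewrite !horner2_swapXY; case: ltgtP.
Qed.

Definition sym_scale c (w : symbol) :=
  Symbol (c *: sym0 w) (c%:P *: sym1 w) (c%:P *: sym2 w).

Lemma sym_scale_mulE c w y : sym_mul (sym_scale c w) y = c * sym_mul w y.
Proof. by rewrite /sym_mul /=; case: ifP => _; rewrite ?mulr0// hornerZ. Qed.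

Lemma sym_scale_kerE c w y z : sym_ker (sym_scale c w) y z = c * sym_ker w y z.
Proof.
rewrite /sym_ker /=; case: ifP => _; last by rewrite mulr0.
rewrite !hornerZ !hornerM !hornerC.
by case: ltgtP => _; rewrite ?mulr0.
Qed.

Definition sym_one := Symbol 1 0 0.

Lemma sym_one_mul : \forall y \ae nu, sym_mul sym_one y = 1.
Proof. by apply: ae_imply ae_itv => y yI; rewrite /sym_mul yI hornerE. Qed.

Lemma sym_one_ker y z : sym_ker sym_one y z = 0.
Proof. by rewrite /sym_ker /= !horner0; case: ifP => // _; case: ltgtP. Qed.

Definition Op_itv (w : symbol) : L2itv a b -> L2itv a b :=
  L2_op (coordinate_itv ab) (sym_bk w).

Lemma Pi1P (P : L2itv a b -> L2itv a b) : Pi1 a b P <-> exists w, P = Op_itv w.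
Proof.
have iv (v : L2itv a b) : nu.-integrable setT (EFin \o (v : TR -> R)).
  exact: (Lfun2_integrable (itv_measure_fin ab) (Lspace_Lfun2 v)).
split=> [[_ [P0 [P1 [P2 PE]]]]|[w ->]].
  exists (Symbol P0 P1 P2); apply/funext => v; apply: Lspace_ext.
  apply: ae_imply3 (PE v) (OpE (coordinate_itv ab) (sym_bk (Symbol P0 P1 P2)) v) ae_itv.
  by move=> s -> -> sI; rewrite op_symE.
split; first exact: Op_bounded.
exists (sym0 w), (sym1 w), (sym2 w) => v.
apply: ae_imply2 (OpE (coordinate_itv ab) (sym_bk w) v) ae_itv => s -> sI.
by rewrite op_symE.
Qed.

End symbol.

(** * Bounded operators and adjoints on L2 *)

Section L2_operators.
Context d (T : measurableType d) (R : realType) (mu : {measure set T -> \bar R}).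
Local Notation L2 := (LspaceType2 mu).
Implicit Types (u v w : L2) (P Q : L2 -> L2).

Lemma L2dotu0 u : L2dot u 0 = 0.
Proof. by rewrite -(subrr u) L2dotBr subrr. Qed.

Lemma L2dotNr u v : L2dot u (- v) = - L2dot u v.
Proof. by rewrite -sub0r L2dotBr L2dotu0 sub0r. Qed.

Lemma L2dotDr u v w : L2dot u (v + w) = L2dot u v + L2dot u w.
Proof. by rewrite -{1}[w]opprK L2dotBr L2dotNr opprK. Qed.

Lemma L2dotDl u v w : L2dot (u + v) w = L2dot u w + L2dot v w.
Proof. by rewrite L2dotC L2dotDr !(L2dotC w). Qed.

Lemma L2dotZr c u v : L2dot u (c *: v) = c * L2dot u v.
Proof.
have mL2 w : measurable_fun setT (w : T -> R) by have /Lfun2P[] := Lspace_Lfun2 w.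
rewrite -RintegralZl//; last exact: L2_integrableM.
apply: eq_Rintegral_ae.
- exact: measurable_funM.
- by apply: measurable_funM => //; exact: measurable_funM.
by apply: filterS (LspaceZE c v) => x /(_ I)/= ->; rewrite mulrCA.
Qed.

Lemma L2dotZl c u v : L2dot (c *: u) v = c * L2dot u v.
Proof. by rewrite L2dotC L2dotZr L2dotC. Qed.

Lemma L2dot_ge0 u : 0 <= L2dot u u.
Proof. by rewrite -L2norm_sqr sqr_ge0. Qed.

(** Parallelogram law: the gap is the squared norm of u - v. *)
Lemma L2dotD_le u v : L2dot (u + v) (u + v) <= 2 * L2dot u u + 2 * L2dot v v.
Proof.
rewrite -subr_ge0 (_ : _ - _ = L2dot (u - v) (u - v)) ?L2dot_ge0//.
rewrite L2dotBr (L2dotC (u - v) u) (L2dotC (u - v) v) !L2dotBr.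
rewrite L2dotDr !L2dotDl (L2dotC v u); ring.
Qed.

Lemma linear_fun0 P : linear P -> P 0 = 0.
Proof. by move=> lP; have := lP (-1) 0 0; rewrite scaleN1r addNr scaleN1r addNr. Qed.

Lemma linear_funD P u v : linear P -> P (u + v) = P u + P v.
Proof. by move=> lP; have := lP 1 u v; rewrite !scale1r. Qed.

Lemma linear_funZ P c u : linear P -> P (c *: u) = c *: P u.
Proof. by move=> lP; have := lP c u 0; rewrite (linear_fun0 lP) !addr0. Qed.

Lemma bounded_operator0 : bounded_operator (0 : L2 -> L2).
Proof.
apply/bounded_operatorP; split.
  by move=> c u v; rewrite -[LHS]/(0 : L2) -[RHS]/(c *: (0 : L2) + 0) scaler0 addr0.
by exists 0 => // u; rewrite L2dotu0 mul0r.
Qed.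

Lemma bounded_operator_id : bounded_operator (id : L2 -> L2).
Proof. by apply/bounded_operatorP; split => //; exists 1 => // u; rewrite mul1r. Qed.

Lemma bounded_operatorD P Q : bounded_operator P -> bounded_operator Q ->
  bounded_operator (P + Q).
Proof.
move=> /bounded_operatorP[lP [C C0 PC]] /bounded_operatorP[lQ [D D0 QD]].
apply/bounded_operatorP; split.
  move=> c u v; rewrite -![(P + Q) _]/(P _ + Q _) lP lQ scalerDr.
  by rewrite addrACA.
exists (2 * C + 2 * D); first by rewrite addr_ge0 ?mulr_ge0.
move=> u; apply: le_trans (L2dotD_le _ _) _.
have -> : (2 * C + 2 * D) * L2dot u u = 2 * (C * L2dot u u) + 2 * (D * L2dot u u).
  by ring.
by rewrite lerD// ler_pM2l.
Qed.

Lemma bounded_operatorM P Q : bounded_operator P -> bounded_operator Q ->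
  bounded_operator (P \o Q).
Proof.
move=> /bounded_operatorP[lP [C C0 PC]] /bounded_operatorP[lQ [D D0 QD]].
apply/bounded_operatorP; split; first by move=> c u v /=; rewrite lQ lP.
exists (C * D); first exact: mulr_ge0.
by move=> u /=; apply: le_trans (PC _) _; rewrite -mulrA ler_wpM2l.
Qed.

Lemma bounded_operatorZ c P : bounded_operator P -> bounded_operator (c *: P).
Proof.
move=> /bounded_operatorP[lP [C C0 PC]]; apply/bounded_operatorP; split.
  move=> e u v; rewrite -![(c *: P) _]/(c *: P _) lP scalerDr.
  by rewrite !scalerA mulrC.
exists (c ^+ 2 * C); first by rewrite mulr_ge0 ?sqr_ge0.
move=> u; rewrite -![(c *: P) _]/(c *: P _) L2dotZl L2dotZr.
rewrite [leLHS]mulrA -expr2 -[leRHS]mulrA.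
by apply: ler_wpM2l; [exact: sqr_ge0|exact: PC].
Qed.

Lemma is_adjoint0 : is_adjoint (0 : L2 -> L2) 0.
Proof.
split; first exact: bounded_operator0.
by move=> u v; rewrite -![(0 : L2 -> L2) _]/(0 : L2) L2dotC !L2dotu0.
Qed.

Lemma is_adjoint_id : is_adjoint (id : L2 -> L2) id.
Proof. by split => //; exact: bounded_operator_id. Qed.

Lemma is_adjointD P P' Q Q' : is_adjoint P P' -> is_adjoint Q Q' ->
  is_adjoint (P + Q) (P' + Q').
Proof.
move=> [bP hP] [bQ hQ]; split; first exact: bounded_operatorD.
move=> u v; rewrite -[(P + Q) _]/(P _ + Q _) -[(P' + Q') _]/(P' _ + Q' _).
by rewrite L2dotDl L2dotDr hP hQ.
Qed.

Lemma is_adjointM P P' Q Q' : is_adjoint P P' -> is_adjoint Q Q' ->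
  is_adjoint (P \o Q) (Q' \o P').
Proof.
move=> [bP hP] [bQ hQ]; split; first exact: bounded_operatorM.
by move=> u v /=; rewrite hP hQ.
Qed.

Lemma is_adjointZ c P P' : is_adjoint P P' -> is_adjoint (c *: P) (c *: P').
Proof.
move=> [bP hP]; split; first exact: bounded_operatorZ.
move=> u v; rewrite -[(c *: P) _]/(c *: P _) -[(c *: P') _]/(c *: P' _).
by rewrite L2dotZl L2dotZr hP.
Qed.

Lemma is_adjoint_sym P P' : bounded_operator P -> is_adjoint P P' -> is_adjoint P' P.
Proof.
by move=> bP [bP' hP]; split=> // u v; rewrite L2dotC -hP L2dotC.
Qed.

(** Uniqueness turns the choice behind [adjoint] into a computation: it is enough to exhibit one
    adjoint. *)
Lemma adjointP P P' : is_adjoint P P' -> adjoint P = P'.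
Proof.
move=> PP'; apply: (is_adjoint_unique _ PP').
by rewrite /adjoint; case: xgetP => [Q _ //|/(_ P')].
Qed.

End L2_operators.

(** * Products of families that commute across distinct indices *)

Section composition_products.
Context (T : Type) (I : eqType).
Implicit Types (r : seq I) (A B : I -> T -> T).
Local Notation "\cprod_ ( i <- r ) F" := (\big[(fun f g => f \o g)/id]_(i <- r) F)
  (at level 36, F at level 36, i, r at level 50).

Lemma cprod_commute r A (f : T -> T) : (forall i, i \in r -> A i \o f = f \o A i) ->
  (\cprod_(i <- r) A i) \o f = f \o (\cprod_(i <- r) A i).
Proof.
elim: r => [|i r ih] cA; first by rewrite big_nil.
rewrite big_cons -[LHS]/(A i \o ((\cprod_(i <- r) A i) \o f)) ih; last first.
  by move=> k kr; rewrite cA// in_cons kr orbT.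
by rewrite -[LHS]/((A i \o f) \o _) cA// in_cons eqxx.
Qed.

(** Each [B i] moves left past the factors [A k] that follow [A i]; these have k != i because [r]
    has no repetition. [A i] and [B i] are never exchanged, since operators on the same variable do
    not commute in general. *)
Lemma cprod_comp r A B : uniq r ->
  (forall i k, i != k -> A i \o B k = B k \o A i) ->
  (\cprod_(i <- r) A i) \o (\cprod_(i <- r) B i) = \cprod_(i <- r) (A i \o B i).
Proof.
move=> + cAB; elim: r => [|i r ih] /=; first by rewrite !big_nil.
move=> /andP[ir ur]; rewrite !big_cons -ih//.
rewrite -[LHS]/(A i \o (((\cprod_(i <- r) A i) \o B i) \o _)).
rewrite (@cprod_commute r A (B i))// => k kr; apply: cAB.
by apply: contraNneq ir => <-.
Qed.

Lemma cprod_id r : \cprod_(i <- r) (@id T) = id.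
Proof. by elim: r => [|i r ih]; rewrite ?big_nil// big_cons ih. Qed.

End composition_products.

(** Taking adjoints reverses the order of the factors, and commutation of the [B i] restores it. *)
Lemma is_adjoint_cprod d (T : measurableType d) (R : realType)
    (mu : {measure set T -> \bar R}) (I : eqType) (r : seq I)
    (A B : I -> LspaceType2 mu -> LspaceType2 mu) : uniq r ->
  (forall i, is_adjoint (A i) (B i)) ->
  (forall i k, i != k -> B i \o B k = B k \o B i) ->
  is_adjoint (\big[(fun f g => f \o g)/id]_(i <- r) A i)
             (\big[(fun f g => f \o g)/id]_(i <- r) B i).
Proof.
move=> + AB cB; elim: r => [|i r ih] /=.
  by rewrite !big_nil => _; exact: is_adjoint_id.
move=> /andP[ir ur]; rewrite !big_cons.
rewrite -(@cprod_commute _ _ r B (B i)); first exact: is_adjointM (AB i) (ih ur).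
by move=> k kr; apply: cB; apply: contraNneq ir => <-.
Qed.

(** * The algebra of N-dimensional 3-PI operators *)

Section PiN_algebra.
Context (R : realType) (N : nat) (a b : 'I_N -> R).
Hypothesis ab : forall i, a i <= b i.
Local Notation TR := (measurableTypeR R).
Local Notation mu := (box_measure a b).
Local Notation nu i := (itv_measure (a i) (b i)).
Local Notation L2 := (L2box a b).
Local Notation co := (coordinate_box ab).

Definition Op_box (i : 'I_N) (w : symbol R) : L2 -> L2 :=
  L2_op (co i) (sym_bk (a i) (b i) w).

(** The class of the slice of [v], square integrable for almost every s, is the required witness. By
    [coord_prsb] and [coord_sbsb], the kernel formula at [set_coord i s t] is the one-variable
    formula for this slice at t. *)
Lemma Op_box_acts i w : acts_on_coord (Op_itv (ab i) w) (Op_box i w).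
Proof.
move=> v; have OpE_slices := ae_slices (co i) (OpE (co i) (sym_bk (a i) (b i) w) v).
apply: (ae_imply2 _ (slice_Lfun2 (co i) (Lspace_Lfun2 v)) OpE_slices).
move=> s vs2 Qs; have /Lfun2P[mvs _] := vs2.
pose vs : L2itv (a i) (b i) := Lclass (Lfun_Sub (lee1n 2) vs2).
have vsE : \forall t \ae nu i, (vs t : R) = v (set_coord i s t).
  by apply: (ae_imply _ (Lclass_ae (Lfun_Sub (lee1n 2) vs2))) => t; exact.
exists vs; first by apply: (ae_imply _ vsE) => t ->.
have Ps := op_OpE (coordinate_itv (ab i)) (sym_bk (a i) (b i) w) mvs vsE.
apply: (ae_imply2 _ Ps Qs) => t Pt Qt _; rewrite [LHS]Pt [RHS]Qt /kernel_op /integral_op /=.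
rewrite (coord_prsb (co i)); congr (_ + _); apply: eq_Rintegral => r _.
by rewrite (coord_sbsb (co i)).
Qed.

(** Allows the unspecified extensions in [PiN] to be replaced by [Op_box]. The relation fixes almost
    every slice of [Q v], and [ae_of_slices] applies because two measurable functions differ on a
    measurable set. *)
Lemma acts_on_coord_unique i (P : L2itv (a i) (b i) -> L2itv (a i) (b i))
    (Q Q' : L2 -> L2) : acts_on_coord P Q -> acts_on_coord P Q' -> Q = Q'.
Proof.
move=> PQ PQ'; apply/funext => v; apply: Lspace_ext.
have mL2 (u : L2) : measurable_fun setT (u : N.-tuple TR -> R).
  by have /Lfun2P[] := Lspace_Lfun2 u.
apply: (ae_of_slices (co i)).
  rewrite (_ : [set x | _] = setT `&` [set x | (Q v x : R)%:E != (Q' v x : R)%:E]).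
    by apply: measurable_neqe => //; exact/measurable_EFinP.
  rewrite setTI; apply/seteqP; split=> x /=.
    by move/eqP; rewrite eqe.
  by rewrite eqe => /eqP.
apply: (ae_imply2 _ (PQ v) (PQ' v)) => s [w vw QPw] [w' vw' QPw'].
have ww' : w = w'.
  apply: Lspace_ext; apply: (ae_imply2 _ vw vw') => t /(_ I)/= -> /(_ I)/= ->.
  by [].
rewrite -{w' vw'}ww' in QPw'.
by apply: (ae_imply2 _ QPw QPw') => t /(_ I)/= <- /(_ I)/= <-.
Qed.

Lemma Op_box_commute i k w w' : i != k ->
  Op_box i w \o Op_box k w' = Op_box k w' \o Op_box i w.
Proof.
move=> ik; apply/funext => u /=; apply: Lspace_ext.
have mu2 : measurable_fun setT (u : N.-tuple TR -> R).
  by have /Lfun2P[] := Lspace_Lfun2 u.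
have iu : mu.-integrable setT (EFin \o (u : N.-tuple TR -> R)).
  exact: (Lfun2_integrable (coord_fin1 (co i)) (Lspace_Lfun2 u)).
set bi := sym_bk (a i) (b i) w; set bk := sym_bk (a k) (b k) w'.
have h1 := op_OpE (co i) bi (measurable_op (co k) bk mu2) (OpE (co k) bk u).
have h2 := op_OpE (co k) bk (measurable_op (co i) bi mu2) (OpE (co i) bi u).
have hC := @op_commute _ _ _ _ _ _ _ _ _ _ _ _ _ _ (co i) (co k) _ _ _ bi bk u iu.
apply: (ae_imply3 _ h1 h2 (hC _ _ _)) => [s -> -> ->//|s t|s t|s t r].
- by rewrite tnth_set_coord eq_sym (negbTE ik).
- by rewrite tnth_set_coord (negbTE ik).
- exact: set_coordC.
Qed.

Lemma Op_box_comp i w1 w2 : exists w3, Op_box i w1 \o Op_box i w2 = Op_box i w3.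
Proof.
have [w3 [hm hk]] := sym_comp (ab i) w1 w2; exists w3.
by apply: Op_comp; [exact: aeW|exact: hk].
Qed.

Lemma Op_box_linear i w : linear (Op_box i w).
Proof. exact: Op_linear. Qed.

Lemma Op_box_adjoint i w : is_adjoint (Op_box i w) (Op_box i (sym_tr w)).
Proof. by apply: Op_adjoint => // y z; exact: sym_trE. Qed.

Lemma Op_box_scale i c w : c *: Op_box i w = Op_box i (sym_scale c w).
Proof.
by apply: Op_scale => [y|y z]; [exact: sym_scale_mulE|exact: sym_scale_kerE].
Qed.

Lemma Op_box_one i : Op_box i (sym_one R) = id.
Proof. by apply: Op_id => [|y z]; [exact: sym_one_mul|exact: sym_one_ker]. Qed.

Definition Op_prod (W : 'I_N -> symbol R) : L2 -> L2 :=
  \big[(fun f g => f \o g)/id]_(i < N) Op_box i (W i).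

(** With lists of symbol families, adding two sums is concatenation and induction runs over the
    terms. *)
Definition Op_sums : set (L2 -> L2) :=
  [set P | exists l : seq ('I_N -> symbol R), P = \sum_(W <- l) Op_prod W].

Lemma Op_prod_adjoint W : is_adjoint (Op_prod W) (Op_prod (fun i => sym_tr (W i))).
Proof.
apply: is_adjoint_cprod => [|i|i k]; first exact: index_enum_uniq.
  exact: Op_box_adjoint.
exact: Op_box_commute.
Qed.

Lemma Op_prod_bounded W : bounded_operator (Op_prod W).
Proof.
rewrite /Op_prod; elim/big_ind: _ => [|P Q bP bQ|i _].
- exact: bounded_operator_id.
- exact: bounded_operatorM.
- exact: Op_bounded.
Qed.

Lemma Op_prod_comp W1 W2 : exists W3, Op_prod W1 \o Op_prod W2 = Op_prod W3.
Proof.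
have /choice[W3 hW3] i := Op_box_comp i (W1 i) (W2 i).
exists W3; rewrite /Op_prod cprod_comp; first by apply: eq_bigr => i _; exact: hW3.
- exact: index_enum_uniq.
- by move=> i k ik; exact: Op_box_commute.
Qed.

(** The scalar is absorbed by the symbol of the first variable, passing through the factors to its
    left by linearity. For N = 0 the only product is [id] and the sums of products are its natural
    multiples, so there scaling would fail. *)
Lemma Op_prod_scale c W : (0 < N)%N -> exists W', c *: Op_prod W = Op_prod W'.
Proof.
move=> N0; pose i0 := Ordinal N0.
pose W' i := if i == i0 then sym_scale c (W i) else W i; exists W'.
rewrite /Op_prod; have := mem_index_enum i0; have := index_enum_uniq 'I_N.
elim: (index_enum _) => [//|i r ih] /= /andP[ir ur].
rewrite in_cons !big_cons => /predU1P[i0i|i0r].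
  rewrite -[LHS]/((c *: Op_box i (W i)) \o _) Op_box_scale {1}/W' -i0i eqxx.
  congr (_ \o _); rewrite big_seq [RHS]big_seq; apply: eq_bigr => k kr.
  by rewrite /W' ifN//; apply: contraNneq ir => ki0; rewrite -i0i -ki0.
rewrite -ih// {1}/W' ifN; last by apply: contraNneq ir => ->.
apply/funext => u; rewrite -[LHS]/(c *: Op_box i (W i) _).
by rewrite -(linear_funZ _ _ (@Op_box_linear i (W i))).
Qed.

Lemma Op_prod_one : Op_prod (fun=> sym_one R) = id.
Proof.
by rewrite /Op_prod -[RHS](cprod_id _ (index_enum 'I_N)); apply: eq_bigr => i _;
  exact: Op_box_one.
Qed.

Lemma Op_sums_prod W : Op_sums (Op_prod W).
Proof. by exists [:: W]; rewrite big_seq1. Qed.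

Lemma Op_sums0 : Op_sums 0.
Proof. by exists [::]; rewrite big_nil. Qed.

Lemma Op_sumsD P Q : Op_sums P -> Op_sums Q -> Op_sums (P + Q).
Proof. by move=> [l ->] [l' ->]; exists (l ++ l'); rewrite big_cat. Qed.

Lemma Op_sums_ind (K : (L2 -> L2) -> Prop) : K 0 ->
  (forall W P, Op_sums P -> K P -> K (Op_prod W + P)) -> forall P, Op_sums P -> K P.
Proof.
move=> K0 KD P [l ->]; elim: l => [|W l ih]; first by rewrite big_nil.
by rewrite big_cons; apply: KD => //; exists l.
Qed.

Lemma Op_sums_bounded P : Op_sums P -> bounded_operator P.
Proof.
move: P; apply: Op_sums_ind => [|W P _ bP]; first exact: bounded_operator0.
by apply: bounded_operatorD => //; exact: Op_prod_bounded.
Qed.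

Lemma Op_sums_comp P Q : Op_sums P -> Op_sums Q -> Op_sums (P \o Q).
Proof.
move=> + SQ; move: P; apply: Op_sums_ind => [|W P _ SPQ]; first exact: Op_sums0.
suff SWQ : Op_sums (Op_prod W \o Q) by exact: (Op_sumsD SWQ SPQ).
have [lW _] := Op_prod_bounded W.
move: Q SQ {SPQ}; apply: Op_sums_ind => [|W' Q _ SWQ].
  rewrite (_ : Op_prod W \o 0 = 0); first exact: Op_sums0.
  by apply/funext => u; rewrite /= (linear_fun0 lW).
rewrite (_ : Op_prod W \o (Op_prod W' + Q) =
  (Op_prod W \o Op_prod W') + (Op_prod W \o Q)); last first.
  by apply/funext => u; exact: (linear_funD (Op_prod W' u) (Q u) lW).
apply: Op_sumsD SWQ; have [W3 ->] := Op_prod_comp W W'; exact: Op_sums_prod.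
Qed.

Lemma Op_sums_adjoint P : Op_sums P -> exists2 P', Op_sums P' & is_adjoint P P'.
Proof.
move: P; apply: Op_sums_ind => [|W P _ [P' SP' PP']].
  by exists 0; [exact: Op_sums0|exact: is_adjoint0].
exists (Op_prod (fun i => sym_tr (W i)) + P').
  by apply: Op_sumsD => //; exact: Op_sums_prod.
by apply: is_adjointD => //; exact: Op_prod_adjoint.
Qed.

Lemma Op_sumsZ c P : (0 < N)%N -> Op_sums P -> Op_sums (c *: P).
Proof.
move=> N0; move: P; apply: Op_sums_ind => [|W P _ ScP].
  by rewrite scaler0; exact: Op_sums0.
rewrite scalerDr; apply: Op_sumsD => //.
by have [W' ->] := Op_prod_scale c W N0; exact: Op_sums_prod.
Qed.

Lemma PiNE : PiN a b = Op_sums.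
Proof.
apply/seteqP; split=> P.
  move=> [_ [M [p [Q [pPi Qacts ->]]]]].
  have /choice[w pw] (ji : 'I_M * 'I_N) : exists w, p ji.1 ji.2 = Op_itv (ab ji.2) w.
    exact/Pi1P.
  exists [seq (fun i => w (j, i)) | j <- index_enum 'I_M].
  rewrite big_map; apply: eq_bigr => j _; apply: eq_bigr => i _.
  apply: (acts_on_coord_unique (Qacts j i)); rewrite (pw (j, i)).
  exact: Op_box_acts.
move=> SP; split; first exact: Op_sums_bounded.
(* [W0] is the default of [nth], never reached by indices below [size l]. *)
case: SP => l ->; pose W0 : 'I_N -> symbol R := fun=> sym_one R.
exists (size l), (fun j i => Op_itv (ab i) (nth W0 l j i)),
  (fun j i => Op_box i (nth W0 l j i)); split.
- by move=> j i; apply/Pi1P; exists (nth W0 l j i).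
- by move=> j i; exact: Op_box_acts.
- by rewrite (big_nth W0) big_mkord.
Qed.

End PiN_algebra.

Theorem proposition32 (R : realType) (N : nat) (a b : 'I_N -> R)
    (N_gt0 : (0 < N)%N) (le_ab : forall i, a i <= b i) :
  (forall P, PiN a b P -> is_adjoint P (adjoint P)) /\
  is_star_algebra (PiN a b) (fun P Q => P \o Q)
    (@adjoint _ _ R (box_measure a b)).
Proof.
have bounded := Op_sums_bounded (ab := le_ab).
have adjP P : Op_sums le_ab P ->
    Op_sums le_ab (adjoint P) /\ is_adjoint P (adjoint P).
  by move=> /Op_sums_adjoint[P' SP' PP']; rewrite (adjointP PP').
rewrite (PiNE le_ab); split; first by move=> P /adjP[].
split.
- exact: Op_sums0.
- exact: Op_sumsD.
- by move=> c P; exact: Op_sumsZ.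
- exact: Op_sums_comp.
- by [].
- by [].
- move=> P Q Q' SP _ _; apply/funext => u.
  exact: (linear_funD (Q u) (Q' u) (bounded _ SP).1).
- by [].
- move=> c P Q SP _; apply/funext => u.
  exact: (linear_funZ c (Q u) (bounded _ SP).1).
- by exists id => //; rewrite -(Op_prod_one le_ab); exact: Op_sums_prod.
- by move=> P /adjP[].
(* [is_adjoint] asks the adjoint to be bounded, so for P to be the adjoint of its adjoint, P itself
   must be known to be bounded. *)
- move=> P SP; have [_ PP'] := adjP P SP.
  exact/adjointP/is_adjoint_sym/PP'/bounded.
- move=> P Q /adjP[_ PP'] /adjP[_ QQ']; exact/adjointP/is_adjointD.
- move=> c P /adjP[_ PP']; exact/adjointP/is_adjointZ.
- move=> P Q /adjP[_ PP'] /adjP[_ QQ']; exact/adjointP/is_adjointM.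
Qed.
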